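(* There is an algorithm which, given strongly connected permutation digraphs $G_a$ and $G_b$ on $n$ vertices, each of degree $d$, correctly tests in $O(n^2+dn\log n)$ time and $O(dn)$ space whether $G_a$ and $G_b$ are color-isomorphic.
   Context: For a $d$-tuple $a=(a_1,\dots,a_d)$ of permutations of $[n]=\{1,\dots,n\}$, the permutation digraph $G_a$ has vertex set $[n]$ and arcs $(i,a_k)$, $i\in[n]$, $k\in[d]$; the arc $(i,a_k)$ goes from $i$ to $a_k(i)$ and has color $k$; its degree is $d$. It is strongly connected if every vertex is reachable from every other by a directed walk. A color-isomorphism of $G_a$ onto $G_b$ is a pair of bijections on vertices and on arcs preserving initial vertices, terminal vertices and colors of arcs. The model of computation is a $b$-bit RAM with $n,d=O(2^b)$. *)

(* Defs.v *)
From mathcomp Require Import all_boot all_fingroup.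

Set Implicit Arguments.
Unset Strict Implicit.
Unset Printing Implicit Defensive.

Record cdigraph (K : Type) := CDigraph {
  vertex : finType;
  arc : finType;
  ini : arc -> vertex;
  ter : arc -> vertex;
  color : arc -> K }.

Definition adjacent (K : Type) (G : cdigraph K) : rel (vertex G) :=
  [rel x y | [exists e : arc G, (ini e == x) && (ter e == y)]].

Definition strongly_connected (K : Type) (G : cdigraph K) : Prop :=
  forall x y : vertex G, connect (@adjacent K G) x y.

Definition color_isomorphism (K : Type) (G H : cdigraph K)
    (f : vertex G -> vertex H) (g : arc G -> arc H) : Prop :=
  [/\ bijective f,
      bijective g,
      forall e, ini (g e) = f (ini e),
      forall e, ter (g e) = f (ter e) &
      forall e, color (g e) = color e].

Definition color_isomorphic (K : Type) (G H : cdigraph K) : Prop :=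
  exists (f : vertex G -> vertex H) (g : arc G -> arc H),
    color_isomorphism f g.

(* Vertices and colours are numbered from 0.  The pair (i, k) is the arc
   (i, a_k), so equal permutations of different colours give parallel arcs. *)
Definition perm_digraph (n d : nat) (a : d.-tuple {perm 'I_n}) :
    cdigraph 'I_d :=
  @CDigraph 'I_d 'I_n ('I_n * 'I_d)%type
    (fun e => e.1) (fun e => tnth a e.2 e.1) (fun e => e.2).

Inductive binop :=
  | Wadd | Wsub | Wmul | Wdiv | Wmod | Wand | Wor | Wxor | Wshl | Wshr.

(* Operands r, s, t are register numbers.  An address is a list of registers,
   least significant word first: a w-bit word can only distinguish 2^w cells,
   which is fewer than the d n entries of a table when n and d are of order
   2^w, so that an address has to span several words.  The length of each such
   list is fixed by the program. *)
Inductive instr :=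
  | Const (r v : nat)
  | Op (o : binop) (r s t : nat)
  | Read (r : nat) (addr : seq nat)
  | Write (addr : seq nat) (r : nat)
  | Jeq (s t l : nat)
  | Jlt (s t l : nat)
  | Halt (answer : bool).

Definition program := seq instr.

(* All values stored are less than 2^w as soon as the initial ones are, since
   every operation is reduced modulo 2^w. *)
Record config := Config {
  pc : nat;
  regs : nat -> nat;
  mem : nat -> nat }.

Definition update (f : nat -> nat) (i v : nat) : nat -> nat :=
  fun j => if j == i then v else f j.

(* Division by 0 gives 0 and the remainder modulo 0 of x is x. *)
Definition eval_op (w : nat) (o : binop) (x y : nat) : nat :=
  (match o with
   | Wadd => x + y
   | Wsub => x + 2 ^ w - y
   | Wmul => x * y
   | Wdiv => x %/ y
   | Wmod => x %% y
   | Wand => Nat.land x y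
   | Wor => Nat.lor x y
   | Wxor => Nat.lxor x y
   | Wshl => x * 2 ^ y
   | Wshr => x %/ 2 ^ y
   end) %% 2 ^ w.

Definition address (w : nat) (s : config) (addr : seq nat) : nat :=
  foldr (fun r v => regs s r + 2 ^ w * v) 0 addr.

Definition exec (w : nat) (i : instr) (s : config) : config :=
  let: Config p rg m := s in
  match i with
  | Const r v => Config p.+1 (update rg r (v %% 2 ^ w)) m
  | Op o r x y => Config p.+1 (update rg r (eval_op w o (rg x) (rg y))) m
  | Read r addr => Config p.+1 (update rg r (m (address w s addr))) m
  | Write addr r => Config p.+1 rg (update m (address w s addr) (rg r))
  | Jeq x y l => Config (if rg x == rg y then l else p.+1) rg m
  | Jlt x y l => Config (if rg x < rg y then l else p.+1) rg m
  | Halt _ => s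
  end.

Definition current (P : program) (s : config) : option instr := onth P (pc s).

(* A jump outside the program blocks the machine without halting it. *)
Definition step (w : nat) (P : program) (s : config) : config :=
  if current P s is Some i then exec w i s else s.

Definition start (x : seq nat) : config :=
  Config 0 (fun=> 0) (fun j => nth 0 x j).

Definition run (w : nat) (P : program) (x : seq nat) (u : nat) : config :=
  iter u (step w P) (start x).

Definition accessed (w : nat) (P : program) (s : config) : option nat :=
  match current P s with
  | Some (Read _ addr) => Some (address w s addr)
  | Some (Write addr _) => Some (address w s addr)
  | _ => None
  end.

(* Space is measured by the largest address in use, the input included, and
   not merely by the number of distinct cells visited.  The registers are not
   counted, as a program only mentions a fixed number of them. *)
Definition computes (w : nat) (P : program) (x : seq nat)
    (time space : nat) (answer : bool) : Prop :=
  [/\ exists2 u, u <= time & current P (run w P x u) = Some (Halt answer),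
      size x <= space &
      forall u A, accessed w P (run w P x u) = Some A -> A < space].

Definition words (w m x : nat) : seq nat :=
  mkseq (fun j => (x %/ 2 ^ (w * j)) %% 2 ^ w) m.

(* A number of words which suffices for every number up to c 2^w, whatever
   the positive word length w is. *)
Definition width (c : nat) : nat := (up_log 2 c.+1).+1.

Lemma width_fit (c w x : nat) : 0 < w -> x <= c * 2 ^ w ->
  x < 2 ^ (w * width c).
Proof.
move=> w_gt0 le_x; apply: (leq_ltn_trans le_x).
rewrite /width mulnS expnD mulnC ltn_pmul2l ?expn_gt0 //.
apply: (leq_trans (up_logP c.+1 (isT : 1 < 2))).
by rewrite leq_pexp2l // leq_pmull.
Qed.

(* The values of a, one permutation after the other. *)
Definition table (n d : nat) (a : d.-tuple {perm 'I_n}) : seq nat :=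
  [seq val (tnth a k i) | k <- enum 'I_d, i <- enum 'I_n].

Definition input (w m n d : nat) (a a' : d.-tuple {perm 'I_n}) : seq nat :=
  flatten [seq words w m x | x <- [:: n, d & table a ++ table a']].

(* Main.v *)
Require Import Defs.
From mathcomp Require Import all_boot all_fingroup.
From mathcomp Require Import zify.

Set Implicit Arguments.
Unset Strict Implicit.
Unset Printing Implicit Defensive.

(* An isomorphism f of strongly connected permutation digraphs is determined
   by the image y of one vertex x, and a search of the first graph from x,
   run in parallel in the second graph from y, either succeeds in extending
   x |-> y to an isomorphism or finds two walks which end in the same vertex
   when started at x, but not when started at y; this takes O(dn) steps.  In
   the second case the property of a vertex that the two walks from it have the
   same end is preserved by every isomorphism, and evaluating it takes O(n)
   steps.  So keep vertex sets X and Y of equal size s such that every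
   isomorphism maps X onto Y, choose x in X and y in Y, and, if the search
   fails, split both sets by this property.  If the parts have different sizes
   there is no isomorphism; otherwise replace X and Y by their smaller
   corresponding parts, which are not empty because of x and y.  As s is at
   least halved, there are O(log n) searches, and the splittings take
   O(n (n + n/2 + n/4 + ...)) = O(n^2) steps in all. *)

(** * Arithmetic on numbers of several words *)

(** The machine shapes half of the proof. With n and d as large as [c * 2 ^ w], neither a vertex nor
    an address need fit in a word, so every number occupies [M] words, where [M] is fixed by [c]
    alone and serves all [w]. The algorithm is therefore written in a small language whose only
    arithmetic is addition, and compiling it costs a factor [slowdown] that depends only on [M] and
    the number of arrays. Products of variables are avoided: a color is represented by the offset k
    n of its permutation in the table, so a table entry is found by adding three numbers. The
    vertices found by a search, each with the arc by which it was found, form a tree. This tree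
    describes one walk per node, and these walks can be followed from any vertex of either graph.
    The search never tests whether the images are distinct: without a mismatch it yields a
    homomorphism, which strong connectivity of the second graph makes surjective, hence
    bijective. *)

Definition instr_at (P : program) (p : nat) (i : instr) : Prop :=
  onth P p = Some i.

Fixpoint code_at (P : program) (p : nat) (c : seq instr) : Prop :=
  if c is i :: c' then instr_at P p i /\ code_at P p.+1 c' else True.

Lemma code_at_cat P p c1 c2 :
  code_at P p (c1 ++ c2) -> code_at P p c1 /\ code_at P (p + size c1) c2.
Proof.
elim: c1 p => [|i c1 IH] p /=; first by rewrite addn0.
by case=> E /IH [? ?]; rewrite addnS -addSn.
Qed.

Lemma code_at_self P c1 c2 : P = c1 ++ c2 -> code_at P (size c1) c2.
Proof.
elim: c2 c1 => //= i c2 IH c1 eP; split.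
  by rewrite /instr_at eP; elim: (c1) => //=.
by rewrite -(size_rcons c1 i); apply: IH; rewrite cat_rcons.
Qed.

Section Machine.

Variables (w S : nat) (P : program).

(** The lemmas about pieces of code are stated with a continuation: given a run of [T] steps from
    the end of the code, they yield a run from its beginning. Pieces are thus chained by applying
    lemmas, and their times add up. Addresses are constrained only before step [u]; [computes_reach]
    deals with the time after halting. *)
Definition reach (s : config) (T : nat) (Q : config -> Prop) : Prop :=
  exists u, [/\ u <= T, Q (iter u (step w P) s) &
    forall v A, v < u -> accessed w P (iter v (step w P) s) = Some A -> A < S].

Lemma reach_refl s T (Q : config -> Prop) : Q s -> reach s T Q.
Proof. by exists 0. Qed.

Lemma reach_step s T Q :
  (forall A, accessed w P s = Some A -> A < S) ->
  reach (step w P s) T Q -> reach s T.+1 Q.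
Proof.
move=> safe [u [le_u Qu safe_u]]; exists u.+1; split=> //.
  by rewrite iterSr.
by case=> [|v] A; [move=> _; apply: safe | rewrite iterSr; apply: safe_u].
Qed.

Lemma reach_weaken s T T' (Q Q' : config -> Prop) :
  reach s T Q -> T <= T' -> (forall s', Q s' -> Q' s') -> reach s T' Q'.
Proof.
move=> [u [le_u Qu safe]] leT sub; exists u; split=> //; last exact: sub.
exact: leq_trans leT.
Qed.

Section Instructions.

Variables (p : nat) (rg m : nat -> nat) (T : nat) (Q : config -> Prop).

Lemma reach_const r v : instr_at P p (Const r v) ->
  reach (Config p.+1 (update rg r (v %% 2 ^ w)) m) T Q ->
  reach (Config p rg m) T.+1 Q.
Proof.
rewrite /instr_at => E H.
by apply: reach_step; rewrite /accessed /step /current /= E.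
Qed.

Lemma reach_op o r x y : instr_at P p (Op o r x y) ->
  reach (Config p.+1 (update rg r (eval_op w o (rg x) (rg y))) m) T Q ->
  reach (Config p rg m) T.+1 Q.
Proof.
rewrite /instr_at => E H.
by apply: reach_step; rewrite /accessed /step /current /= E.
Qed.

Lemma reach_read r l (a := address w (Config p rg m) l) :
  instr_at P p (Read r l) -> a < S ->
  reach (Config p.+1 (update rg r (m a)) m) T Q ->
  reach (Config p rg m) T.+1 Q.
Proof.
rewrite /instr_at => E lt_a H.
apply: reach_step; rewrite /accessed /step /current /= E //.
by move=> _ [<-].
Qed.

Lemma reach_write r l (a := address w (Config p rg m) l) :
  instr_at P p (Write l r) -> a < S ->
  reach (Config p.+1 rg (update m a (rg r))) T Q ->
  reach (Config p rg m) T.+1 Q.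
Proof.
rewrite /instr_at => E lt_a H.
apply: reach_step; rewrite /accessed /step /current /= E //.
by move=> _ [<-].
Qed.

Lemma reach_jeq x y l : instr_at P p (Jeq x y l) ->
  reach (Config (if rg x == rg y then l else p.+1) rg m) T Q ->
  reach (Config p rg m) T.+1 Q.
Proof.
rewrite /instr_at => E H.
by apply: reach_step; rewrite /accessed /step /current /= E.
Qed.

Lemma reach_jlt x y l : instr_at P p (Jlt x y l) ->
  reach (Config (if rg x < rg y then l else p.+1) rg m) T Q ->
  reach (Config p rg m) T.+1 Q.
Proof.
rewrite /instr_at => E H.
by apply: reach_step; rewrite /accessed /step /current /= E.
Qed.

End Instructions.

(* The number whose digits in base 2^w are f j, ..., f (j + q - 1), the least
   significant one first. *)
Definition digits (f : nat -> nat) (j q : nat) : nat :=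
  foldr (fun i v => f i + 2 ^ w * v) 0 (iota j q).

Lemma digitsS f j q : digits f j q.+1 = f j + 2 ^ w * digits f j.+1 q.
Proof. by []. Qed.

Lemma digitsD f j q q' :
  digits f j (q + q') = digits f j q + 2 ^ (w * q) * digits f (j + q) q'.
Proof.
elim: q j => [|q IH] j; first by rewrite muln0 expn0 mul1n addn0.
by rewrite addSn !digitsS IH addnS addSn mulnDr addnA mulnA -expnD mulnS.
Qed.

Lemma digits_shift f k j q :
  digits f (k + j) q = digits (fun i => f (k + i)) j q.
Proof. by elim: q j => // q IH j; rewrite !digitsS -addnS IH. Qed.

Lemma eq_digits f g j q : (forall i, j <= i < j + q -> f i = g i) ->
  digits f j q = digits g j q.
Proof.
elim: q j => // q IH j eq_fg; rewrite !digitsS eq_fg; last by lia.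
by rewrite IH // => i lt_i; apply: eq_fg; lia.
Qed.

Lemma digits0 f j q : (forall i, j <= i < j + q -> f i = 0) -> digits f j q = 0.
Proof.
move=> f0; rewrite (@eq_digits _ (fun=> 0)) //.
by elim: q j {f0} => // q IH j; rewrite digitsS IH muln0.
Qed.

Lemma digits_lt f j q : (forall i, f i < 2 ^ w) -> digits f j q < 2 ^ (w * q).
Proof.
move=> lt_f; elim: q j => [|q IH] j; first by rewrite muln0.
rewrite digitsS mulnS expnD; have := IH j.+1; have := lt_f j; nia.
Qed.

Variable M : nat.

(* Registers 0, 1 and 2 are for scratch use; above them, every M registers
   hold one number.  Number 0 is the address in use, numbers 1 and 2 are
   temporaries, and number x + 3 is the variable x of the structured language. *)
Definition reg (X j : nat) : nat := 3 + (X * M + j).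

Lemma reg_inj X Y i j : i < M -> j < M -> reg X i = reg Y j -> X = Y /\ i = j.
Proof.
rewrite /reg => lt_i lt_j /addnI E; have M_gt0: 0 < M by lia.
have /= := congr1 (fun z => z %/ M) E.
rewrite !divnMDl // !divn_small // !addn0 => eqX.
by subst Y; move/addnI: E.
Qed.

Lemma reg_neq X Y i j : X != Y -> i < M -> j < M -> (reg X i == reg Y j) = false.
Proof. by move=> /eqP nXY lt_i lt_j; apply/eqP => /reg_inj []. Qed.

Definition val_of (rg : nat -> nat) (X : nat) : nat :=
  digits (fun j => rg (reg X j)) 0 M.

Definition words_ok (f : nat -> nat) := forall r, f r < 2 ^ w.

Definition same_but (X : nat) (rg rg' : nat -> nat) : Prop :=
  forall Y j, Y != X -> j < M -> rg' (reg Y j) = rg (reg Y j).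

Lemma same_but_val X rg rg' Y :
  same_but X rg rg' -> Y != X -> val_of rg' Y = val_of rg Y.
Proof. by move=> E nYX; apply: eq_digits => j lt_j; apply: E. Qed.

Lemma words_ok_update f r v : words_ok f -> v < 2 ^ w -> words_ok (update f r v).
Proof. by move=> ok lt_v q; rewrite /update; case: eqP. Qed.

Definition block (X : nat) : seq nat := [seq reg X j | j <- iota 0 M].

Lemma address_block p rg m X : address w (Config p rg m) (block X) = val_of rg X.
Proof. by rewrite /address /block foldr_map. Qed.

Lemma digits_eq0 f j q i : digits f j q = 0 -> j <= i < j + q -> f i = 0.
Proof.
elim: q j => [|q IH] j; first by lia.
rewrite digitsS => /eqP; rewrite addn_eq0 muln_eq0 expn_eq0 /= => /andP[/eqP f0 /eqP d0].
by case: (ltngtP j i) => [lt|gt|<- //] le_i; [apply: (IH j.+1) => //; lia | lia].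
Qed.

(* Registers 0, 1 and 2 hold the carry and two partial sums; at most one of
   the two additions overflows, which shows in a sum less than an operand. *)
Fixpoint add_code (p X Y Z j q : nat) : seq instr :=
  if q is q'.+1 then
    [:: Op Wadd 1 (reg X j) 0; Op Wadd 2 1 (reg Y j); Jlt 1 0 (6 + p);
        Const 0 1; Jlt 2 (reg Y j) (6 + p); Const 0 0; Op Wor (reg Z j) 2 2]
    ++ add_code (7 + p) X Y Z j.+1 q'
  else [::].

Lemma size_add_code p X Y Z j q : size (add_code p X Y Z j q) = 7 * q.
Proof. by elim: q p j => //= q IH p j; rewrite IH mulnS. Qed.


Hypothesis w_gt0 : 0 < w.

Lemma word_gt1 : 1 < 2 ^ w.
Proof. by rewrite -{1}(expn0 2) ltn_exp2l. Qed.

(** No instruction copies a register; [Op Wor] with equal operands does it. *)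
Lemma lor_word x : x < 2 ^ w -> Nat.lor x x %% 2 ^ w = x.
Proof. by move=> lt_x; rewrite PeanoNat.Nat.lor_diag modn_small. Qed.

Lemma reach_add_digit p rg m T Q X Y Z j :
  words_ok rg -> rg 0 <= 1 -> j < M ->
  code_at P p (add_code p X Y Z j 1) ->
  (forall rg', words_ok rg' -> rg' 0 <= 1 ->
     (forall r, 2 < r -> r != reg Z j -> rg' r = rg r) ->
     rg' (reg Z j) + 2 ^ w * rg' 0 = rg (reg X j) + rg (reg Y j) + rg 0 ->
     reach (Config (7 + p) rg' m) T Q) ->
  reach (Config p rg m) (7 + T) Q.
Proof.
move=> ok c1 lt_j /= [E0 [E1 [E2 [E3 [E4 [E5 [E6 _]]]]]]] next.
have W1 := word_gt1; have okx := ok (reg X j); have oky := ok (reg Y j).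
(* All paths through the code of one digit meet at its last instruction, [6 + p], with the digit in
   register 2 and the outgoing carry in register 0. *)
have fin q rg1 U : words_ok rg1 -> (forall r, 2 < r -> rg1 r = rg r) ->
    rg1 0 <= 1 ->
    rg1 2 + 2 ^ w * rg1 0 = rg (reg X j) + rg (reg Y j) + rg 0 ->
    q = 6 + p -> T < U -> reach (Config q rg1 m) U Q.
  move=> ok1 fr1 c11 sum -> lt_U.
  apply: (@reach_weaken _ T.+1 _ Q) => //.
  apply: reach_op E6 _.
  apply: next; rewrite /update /=.
  - by apply: words_ok_update => //; rewrite ltn_mod; lia.
  - by rewrite /update.
  - by move=> r lt_r nr; rewrite (negPf nr) fr1.
  - by rewrite eqxx /eval_op lor_word.
have lt_mod v : v %% 2 ^ w < 2 ^ w by rewrite ltn_mod; lia.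
have addw v v' : v < 2 ^ w -> v' < 2 ^ w ->
    exists2 b : bool, (v + v') %% 2 ^ w + b * 2 ^ w = v + v' &
      ((v + v') %% 2 ^ w < v') = b.
  move=> lt_v lt_v'; case: (leqP (2 ^ w) (v + v')) => [le|lt].
    have -> : (v + v') %% 2 ^ w = v + v' - 2 ^ w.
      by rewrite -{1}(subnK le) modnDr modn_small //; lia.
    by exists true; lia.
  by exists false; rewrite modn_small //; lia.
apply: reach_op E0 _; apply: reach_op E1 _; apply: reach_jlt E2 _.
rewrite /update /eval_op /=.
have [//||b1 eq1 ->] := addw (rg (reg X j)) (rg 0); first by lia.
set t := (_ + rg 0) %% _ in eq1 *.
have [||b2 eq2 lt2] := addw t (rg (reg Y j)); [exact: lt_mod | by [] | ].
set u := (t + _) %% _ in eq2 lt2 *.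
have lt_u : u < 2 ^ w by apply: lt_mod.
have lt_t : t < 2 ^ w by apply: lt_mod.
have ok2 : words_ok (fun r => if r == 2 then u else if r == 1 then t else rg r).
  by move=> r; case: ifP => // _; case: ifP.
have fr2 r : 2 < r -> (if r == 2 then u else if r == 1 then t else rg r) = rg r.
  by case: r => [|[|[|r]]].
(* If the first addition overflows, the incoming carry was 1, so register 0 already holds the
   outgoing carry when the jump is taken. *)
case: b1 => /= in eq1 eq2 *.
  by apply: fin => //=; [nia | lia].
apply: reach_const E3 _; rewrite modn_small //.
apply: reach_jlt E4 _; rewrite /update /= lt2.
case: b2 => /= in eq2 lt2 *.
  apply: fin => //=; last by lia.
  - by move=> r; case: ifP => // _; apply: ok2.
  - by case=> [|[|[|r]]].
apply: reach_const E5 _; rewrite mod0n /update.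
apply: fin => //=.
- by move=> r; have := ok2 r; case: r => [|r] //=; lia.
- by case=> [|[|[|r]]].
- nia.
Qed.

Lemma reach_add_code p rg m T Q X Y Z j q :
  words_ok rg -> rg 0 <= 1 -> j + q <= M ->
  code_at P p (add_code p X Y Z j q) ->
  (forall rg', words_ok rg' ->
     (forall r, 2 < r -> (forall i, j <= i < j + q -> r <> reg Z i) ->
       rg' r = rg r) ->
     digits (fun i => rg' (reg Z i)) j q + 2 ^ (w * q) * rg' 0 =
       digits (fun i => rg (reg X i)) j q + digits (fun i => rg (reg Y i)) j q
       + rg 0 ->
     reach (Config (p + 7 * q) rg' m) T Q) ->
  reach (Config p rg m) (7 * q + T) Q.
Proof.
elim: q j p rg => [|q IH] j p rg ok c1 le_q code next.
  have := next rg; rewrite !muln0 !addn0 mul1n; apply=> //.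
case/(@code_at_cat _ _ (add_code p X Y Z j 1)): code => code1 code2.
have lt_j : j < M by lia.
rewrite mulnS -addnA; apply: (reach_add_digit ok c1 lt_j code1).
move=> rg1 ok1 c11 fr1 sum1; apply: (IH j.+1) => //; first by lia.
  by move: code2; rewrite addnC.
move=> rg2 ok2 fr2 sum2.
have -> : 7 + p + 7 * q = p + 7 * q.+1 by lia.
apply: next => //.
  move=> r lt_r nr; rewrite fr2 // ?fr1 //; first by apply/eqP/nr; lia.
  by move=> i lt_i; apply: nr; lia.
rewrite !digitsS.
have eqZ : rg2 (reg Z j) = rg1 (reg Z j).
  by apply: fr2 => // i lt_i /reg_inj []; lia.
(* Only digit [j] of [Z] has changed, so the higher digits of the operands are still the old ones
   even if [Z] is one of them. This permits addition in place. *)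
have eqD V : digits (fun i => rg1 (reg V i)) j.+1 q =
             digits (fun i => rg (reg V i)) j.+1 q.
  apply: eq_digits => i lt_i; apply: fr1 => //.
  by apply/eqP => /reg_inj []; lia.
rewrite -!eqD eqZ mulnS expnD; move: sum1 sum2.
nia.
Qed.

Lemma reach_add p rg m T Q X Y Z :
  words_ok rg ->
  val_of rg X + val_of rg Y < 2 ^ (w * M) ->
  code_at P p (Const 0 0 :: add_code p.+1 X Y Z 0 M) ->
  (forall rg', words_ok rg' -> same_but Z rg rg' ->
     val_of rg' Z = val_of rg X + val_of rg Y ->
     reach (Config (p + (7 * M).+1) rg' m) T Q) ->
  reach (Config p rg m) ((7 * M).+1 + T) Q.
Proof.
move=> ok bound [E0 code] next; rewrite addSn; apply: reach_const E0 _.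
rewrite mod0n.
have W1 := word_gt1.
apply: reach_add_code code _ => //.
  by apply: words_ok_update => //; lia.
move=> rg' ok' fr sum; rewrite addSnnS; apply: next => //.
  move=> Y' j nY lt_j; rewrite fr //; last first.
    by move=> i lt_i /reg_inj [//||/eqP]; [lia | rewrite (negPf nY)].
move: sum bound; rewrite /update /= /val_of addn0 => sum; rewrite -sum.
case: (rg' 0) => [|k]; first by rewrite muln0 addn0.
rewrite mulnS; lia.
Qed.

(* X := b, with b = 0 or 1 *)
Definition set_code (X b : nat) : seq instr :=
  [seq Const (reg X i) (if i == 0 then b else 0) | i <- iota 0 M].

Lemma reach_set_code p rg m T Q X b j q : b <= 1 -> words_ok rg -> j + q <= M ->
  code_at P p [seq Const (reg X i) (if i == 0 then b else 0) | i <- iota j q] ->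
  (forall rg', words_ok rg' ->
    (forall r, (forall i, j <= i < j + q -> r <> reg X i) -> rg' r = rg r) ->
    (forall i, j <= i < j + q -> rg' (reg X i) = if i == 0 then b else 0) ->
    reach (Config (p + q) rg' m) T Q) ->
  reach (Config p rg m) (q + T) Q.
Proof.
have W1 := word_gt1; move=> le_b.
elim: q j p rg => [|q IH] j p rg ok le_q code next.
  by have := next rg; rewrite !addn0; apply=> // i; lia.
case: code => E code; rewrite addSn; apply: reach_const E _.
have lt_v : (if j == 0 then b else 0) < 2 ^ w by case: ifP; lia.
rewrite modn_small //; apply: IH code _; [exact: words_ok_update | lia |].
move=> rg' ok' fr eqX; rewrite addSnnS; apply: next => //.
  move=> r nr; rewrite fr; last by move=> i lt_i; apply: nr; lia.
  by rewrite /update (introF eqP) //; apply: nr; lia.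
move=> i lt_i; case: (ltngtP j i) => [lt|gt|<-]; [apply: eqX; lia | lia |].
by rewrite fr /update ?eqxx // => k lt_k /reg_inj; lia.
Qed.

Lemma reach_set p rg m T Q X b : 0 < M -> b <= 1 -> words_ok rg ->
  code_at P p (set_code X b) ->
  (forall rg', words_ok rg' -> same_but X rg rg' -> val_of rg' X = b ->
    reach (Config (p + M) rg' m) T Q) ->
  reach (Config p rg m) (M + T) Q.
Proof.
move=> M_gt0 le_b ok code next; apply: reach_set_code code _ => //.
move=> rg' ok' fr eqX; apply: next => //.
  move=> Y j nY lt_j; apply: fr => i lt_i.
  by move=> /reg_inj [//||/eqP]; [lia | rewrite (negPf nY)].
rewrite /val_of -(prednK M_gt0) digitsS eqX //= digits0 ?muln0 ?addn0 //.
by move=> [|i] lt_i //; rewrite eqX //=; lia.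
Qed.

(** The most significant words are compared first. [L] is meant to be the position right after this
    code; a strict inequality jumps over the instruction at [L], and equality falls through to
    it. *)
Fixpoint cmp_code (X Y L q : nat) : seq instr :=
  if q is q'.+1 then
    [:: Jlt (reg X q') (reg Y q') L.+1; Jlt (reg Y q') (reg X q') L]
    ++ cmp_code X Y L q'
  else [::].

Lemma size_cmp_code X Y L q : size (cmp_code X Y L q) = 2 * q.
Proof. by elim: q => //= q IH; rewrite IH mulnS. Qed.

Lemma digitsSr f j q :
  digits f j q.+1 = digits f j q + 2 ^ (w * q) * f (j + q).
Proof. by rewrite -addn1 digitsD /digits /= muln0 addn0. Qed.

Lemma reach_cmp_code p rg m T Q X Y L q :
  words_ok rg -> L = p + 2 * q -> code_at P p (cmp_code X Y L q) ->
  reach (Config (if digits (fun i => rg (reg X i)) 0 q <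
      digits (fun i => rg (reg Y i)) 0 q then L.+1 else L) rg m) T Q ->
  reach (Config p rg m) (2 * q + T) Q.
Proof.
move=> ok; elim: q p => [|q IH] p eL code next.
  by move: next; rewrite eL muln0 addn0.
case: code => E1 [E2 code].
have -> : 2 * q.+1 + T = (2 * q + T).+2 by lia.
apply: reach_jlt E1 _.
rewrite !digitsSr !add0n in next.
have dig V : digits (fun i => rg (reg V i)) 0 q < 2 ^ (w * q) by apply: digits_lt.
have dX := dig X; have dY := dig Y.
case: ltngtP => [lt|gt|eq]; last 1 first.
- apply: reach_jlt E2 _; rewrite eq ltnn; apply: (IH p.+2) => //; first by lia.
  by move: next; rewrite eq ltn_add2r.
- have {}next : reach (Config L.+1 rg m) T Q by move: next; case: ltnP => //; nia.
  by apply: (reach_weaken next) => //; lia.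
have {}next : reach (Config L rg m) T Q by move: next; case: ltnP => //; nia.
apply: (@reach_weaken _ T.+1 _ Q) => //; last by lia.
by apply: reach_jlt E2 _; rewrite gt.
Qed.

Lemma reach_cmp p rg m T Q X Y L :
  words_ok rg -> L = p + 2 * M -> code_at P p (cmp_code X Y L M) ->
  reach (Config (if val_of rg X < val_of rg Y then L.+1 else L) rg m) T Q ->
  reach (Config p rg m) (2 * M + T) Q.
Proof. exact: reach_cmp_code. Qed.

Definition addc (p X Y Z : nat) : seq instr :=
  Const 0 0 :: add_code p.+1 X Y Z 0 M.

Lemma size_addc p X Y Z : size (addc p X Y Z) = (7 * M).+1.
Proof. by rewrite /= size_add_code. Qed.

(* Z := Z + k X *)
Fixpoint rep_code (p Z X k : nat) : seq instr :=
  if k is k'.+1 then addc p Z X Z ++ rep_code (p + (7 * M).+1) Z X k' else [::].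

Lemma rep_codeS p Z X k :
  rep_code p Z X k.+1 = addc p Z X Z ++ rep_code (p + (7 * M).+1) Z X k.
Proof. by []. Qed.

Lemma size_rep_code p Z X k : size (rep_code p Z X k) = k * (7 * M).+1.
Proof.
by elim: k p => // k IH p; rewrite rep_codeS size_cat size_addc IH mulSn.
Qed.

Lemma reach_rep p rg m T Q Z X k :
  X != Z -> words_ok rg ->
  val_of rg Z + k * val_of rg X < 2 ^ (w * M) ->
  code_at P p (rep_code p Z X k) ->
  (forall rg', words_ok rg' -> same_but Z rg rg' ->
     val_of rg' Z = val_of rg Z + k * val_of rg X ->
     reach (Config (p + k * (7 * M).+1) rg' m) T Q) ->
  reach (Config p rg m) (k * (7 * M).+1 + T) Q.
Proof.
move=> nX; elim: k p rg => [|k IH] p rg ok bound code next.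
  by have := next rg; rewrite !addn0; apply.
move: code; rewrite rep_codeS => /code_at_cat [code1]; rewrite size_addc => code2.
rewrite mulSn -addnA; apply: reach_add code1 _ => //; first by lia.
move=> rg1 ok1 fr1 eq1.
have eqX := same_but_val fr1 nX.
apply: IH code2 _ => //; first by rewrite eq1 eqX; lia.
move=> rg2 ok2 fr2 eq2.
have -> : p + (7 * M).+1 + k * (7 * M).+1 = p + k.+1 * (7 * M).+1 by lia.
apply: next => //; last by rewrite eq2 eq1 eqX; lia.
by move=> Y j nY lt_j; rewrite fr2 // fr1.
Qed.

(** Number 0 is a running address, and number 2 has to hold 1, by which the address is advanced
    after every word. *)
Fixpoint read_code (p X i q : nat) : seq instr :=
  if q is q'.+1 then
    (Read (reg X i) (block 0) :: addc p.+1 0 2 0)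
      ++ read_code (p + (7 * M).+2) X i.+1 q'
  else [::].

Lemma read_codeS p X i q :
  read_code p X i q.+1 = (Read (reg X i) (block 0) :: addc p.+1 0 2 0)
    ++ read_code (p + (7 * M).+2) X i.+1 q.
Proof. by []. Qed.

Lemma size_read_code p X i q : size (read_code p X i q) = q * (7 * M).+2.
Proof.
elim: q p i => // q IH p i.
by rewrite read_codeS size_cat IH /= size_add_code mulSn.
Qed.

Lemma reach_read_code p rg m T Q X i q (a := val_of rg 0) :
  2 < X -> words_ok rg -> words_ok m -> i + q <= M ->
  val_of rg 2 = 1 -> a + q < 2 ^ (w * M) -> a + q <= S ->
  code_at P p (read_code p X i q) ->
  (forall rg', words_ok rg' ->
     (forall Y j, 1 < Y -> j < M -> (Y = X -> ~~ (i <= j < i + q)) ->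
        rg' (reg Y j) = rg (reg Y j)) ->
     (forall j, j < q -> rg' (reg X (i + j)) = m (a + j)) ->
     reach (Config (p + q * (7 * M).+2) rg' m) T Q) ->
  reach (Config p rg m) (q * (7 * M).+2 + T) Q.
Proof.
move=> lt_X; rewrite /a {a}; elim: q i p rg => [|q IH] i p rg;
  move=> ok okm le_q one bound le_S code next.
  by have := next rg; rewrite !addn0; apply=> // j; lia.
move: code; rewrite read_codeS => /code_at_cat [[E code1]].
rewrite /= size_add_code => code2.
have -> : q.+1 * (7 * M).+2 + T = ((7 * M).+1 + (q * (7 * M).+2 + T)).+1 by lia.
apply: (reach_read E); first by rewrite address_block; lia.
rewrite address_block; set rg1 := update _ _ _.
have fr1 Y j : Y != X -> j < M -> rg1 (reg Y j) = rg (reg Y j).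
  by move=> nY lt_j; rewrite /rg1 /update reg_neq //; lia.
have val1 Y : Y != X -> val_of rg1 Y = val_of rg Y.
  by move=> nY; apply: same_but_val nY => *; apply: fr1.
have ok1 : words_ok rg1 by apply: words_ok_update.
have eqX : rg1 (reg X i) = m (val_of rg 0) by rewrite /rg1 /update eqxx.
have nX : 0 != X /\ 2 != X by lia.
apply: reach_add code1 _ => //; first by rewrite !val1 //; lia.
move=> rg2 ok2 fr2 eq2.
have eqa : val_of rg2 0 = (val_of rg 0).+1 by rewrite eq2 !val1 ?one ?addn1; lia.
have -> : p.+1 + (7 * M).+1 = p + (7 * M).+2 by lia.
apply: IH code2 _ => //; first by lia.
- by rewrite (same_but_val fr2) // val1; lia.
- by rewrite eqa; lia.
- by rewrite eqa; lia.
move=> rg3 ok3 fr3 eq3.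
have -> : p + (7 * M).+2 + q * (7 * M).+2 = p + q.+1 * (7 * M).+2 by lia.
apply: next => //.
  move=> Y j lt_Y lt_j nY; rewrite fr3 // ?fr2 //; [|lia|lia].
  rewrite /rg1 /update; case: eqP => // /reg_inj [//||eY ej]; first by lia.
  by have := nY eY; lia.
case=> [|j] lt_j; last by rewrite addnS -addSn eq3 // eqa addnS.
rewrite !addn0 fr3 ?fr2 //; lia.
Qed.

Fixpoint write_code (p X i q : nat) : seq instr :=
  if q is q'.+1 then
    (Write (block 0) (reg X i) :: addc p.+1 0 2 0)
      ++ write_code (p + (7 * M).+2) X i.+1 q'
  else [::].

Lemma write_codeS p X i q :
  write_code p X i q.+1 = (Write (block 0) (reg X i) :: addc p.+1 0 2 0)
    ++ write_code (p + (7 * M).+2) X i.+1 q.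
Proof. by []. Qed.

Lemma size_write_code p X i q : size (write_code p X i q) = q * (7 * M).+2.
Proof.
elim: q p i => // q IH p i.
by rewrite write_codeS size_cat IH /= size_add_code mulSn.
Qed.

Lemma reach_write_code p rg m T Q X i q (a := val_of rg 0) :
  2 < X -> words_ok rg -> words_ok m -> i + q <= M ->
  val_of rg 2 = 1 -> a + q < 2 ^ (w * M) -> a + q <= S ->
  code_at P p (write_code p X i q) ->
  (forall rg' m', words_ok rg' -> words_ok m' -> same_but 0 rg rg' ->
     (forall b, ~~ (a <= b < a + q) -> m' b = m b) ->
     (forall j, j < q -> m' (a + j) = rg (reg X (i + j))) ->
     reach (Config (p + q * (7 * M).+2) rg' m') T Q) ->
  reach (Config p rg m) (q * (7 * M).+2 + T) Q.
Proof.
move=> lt_X; rewrite /a {a}; elim: q i p rg m => [|q IH] i p rg m;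
  move=> ok okm le_q one bound le_S code next.
  by have := next rg m; rewrite !addn0; apply=> // j; lia.
move: code; rewrite write_codeS => /code_at_cat [[E code1]].
rewrite /= size_add_code => code2.
have -> : q.+1 * (7 * M).+2 + T = ((7 * M).+1 + (q * (7 * M).+2 + T)).+1 by lia.
apply: (reach_write E); first by rewrite address_block; lia.
rewrite address_block; set m1 := update _ _ _.
have ok1 : words_ok m1 by apply: words_ok_update.
apply: reach_add code1 _ => //; first by lia.
move=> rg2 ok2 fr2 eq2.
have eqa : val_of rg2 0 = (val_of rg 0).+1 by lia.
have -> : p.+1 + (7 * M).+1 = p + (7 * M).+2 by lia.
apply: IH code2 _ => //; first by lia.
- by rewrite (same_but_val fr2).
- by rewrite eqa; lia.
- by rewrite eqa; lia.
move=> rg3 m3 ok3 okm3 fr3 out3 in3.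
have -> : p + (7 * M).+2 + q * (7 * M).+2 = p + q.+1 * (7 * M).+2 by lia.
apply: next => //.
- by move=> Y j nY lt_j; rewrite fr3 // fr2.
- move=> b lt_b; rewrite out3; last by rewrite eqa; lia.
  by rewrite /m1 /update; case: eqP => // eb; lia.
case=> [|j] lt_j.
  by rewrite !addn0 out3 ?eqa; [rewrite /m1 /update eqxx | lia].
by rewrite addnS -addSn -eqa in3 // fr2 ?addnS //; lia.
Qed.

End Machine.

(** * A structured language and its compilation *)

Inductive cmd :=
  | Skip
  | Cst (x : nat) (b : bool)
  | Add (x y z : nat)
  | Inp (x y : nat)
  | Get (x j y : nat)
  | Put (j y x : nat)
  | Seq (c1 c2 : cmd)
  | If (x y : nat) (c1 c2 : cmd)
  | While (x y : nat) (c : cmd).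

Record state := State { var : nat -> nat; arr : nat -> nat -> nat }.

Definition set_var (s : state) (x v : nat) : state :=
  State (fun y => if y == x then v else var s y) (arr s).

Definition set_arr (s : state) (j i v : nat) : state :=
  State (var s) (fun k => if k == j then update (arr s k) i v else arr s k).

Section Language.

Variables (bound n_inp : nat) (inp : nat -> nat) (base len n_arr : nat).

(* Variables and array cells hold numbers below bound, array indices are below
   len, and an array access is only allowed while variable 0 holds base, from
   which the compiled code computes addresses. *)
Inductive ev : cmd -> state -> nat -> state -> Prop :=
  | ev_skip s : ev Skip s 0 s
  | ev_cst s x b : ev (Cst x b) s 1 (set_var s x b)
  | ev_add s x y z : var s y + var s z < bound ->
      ev (Add x y z) s 1 (set_var s x (var s y + var s z))
  | ev_inp s x y : var s y < n_inp ->
      ev (Inp x y) s 1 (set_var s x (inp (var s y)))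
  | ev_get s x j y : var s 0 = base -> j < n_arr -> var s y < len ->
      ev (Get x j y) s 1 (set_var s x (arr s j (var s y)))
  | ev_put s x j y : var s 0 = base -> j < n_arr -> var s y < len ->
      ev (Put j y x) s 1 (set_arr s j (var s y) (var s x))
  | ev_seq s c1 c2 t1 t2 s1 s2 : ev c1 s t1 s1 -> ev c2 s1 t2 s2 ->
      ev (Seq c1 c2) s (t1 + t2) s2
  | ev_if_true s x y c1 c2 t s' : var s x < var s y -> ev c1 s t s' ->
      ev (If x y c1 c2) s t.+1 s'
  | ev_if_false s x y c1 c2 t s' : var s y <= var s x -> ev c2 s t s' ->
      ev (If x y c1 c2) s t.+1 s'
  | ev_while_false s x y c : var s y <= var s x -> ev (While x y c) s 1 s
  | ev_while_true s x y c t1 t2 s1 s2 : var s x < var s y -> ev c s t1 s1 ->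
      ev (While x y c) s1 t2 s2 -> ev (While x y c) s (t1 + t2).+1 s2.

Section Compilation.

(* Word length, words per input number, words per variable or array cell. *)
Variables (w m M : nat).

Definition inp_code (y p : nat) : seq instr :=
  set_code M 0 0 ++ rep_code M (p + M) 0 (y + 3) m ++ set_code M 2 1.

Definition cell_code (j y p : nat) : seq instr :=
  let p1 := p + (7 * M).+1 in
  let p2 := p1 + M in
  let p3 := p2 + (M * n_arr) * (7 * M).+1 in
  let p4 := p3 + M in
  addc M p 3 (y + 3) 1 ++ set_code M 0 0 ++ rep_code M p2 0 1 (M * n_arr)
    ++ set_code M 2 1 ++ rep_code M p4 0 2 (M * j).

(** Jumps are absolute, hence the position [p]. [Jeq 0 0] is an unconditional jump; right after a
    comparison it is executed exactly when the test fails, and leads to the second branch or out of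
    the loop. *)
Fixpoint compile (c : cmd) (p : nat) : seq instr :=
  match c with
  | Skip => [::]
  | Cst x b => set_code M (x + 3) b
  | Add x y z => addc M p (y + 3) (z + 3) (x + 3)
  | Inp x y =>
      let b := inp_code y p in
      let p1 := p + size b in
      b ++ set_code M (x + 3) 0 ++ read_code M (p1 + M) (x + 3) 0 m
  | Get x j y =>
      let b := cell_code j y p in b ++ read_code M (p + size b) (x + 3) 0 M
  | Put j y x =>
      let b := cell_code j y p in b ++ write_code M (p + size b) (x + 3) 0 M
  | Seq c1 c2 =>
      let b1 := compile c1 p in b1 ++ compile c2 (p + size b1)
  | If x y c1 c2 =>
      let l := p + 2 * M in
      let b1 := compile c1 l.+1 in
      let l2 := (l.+1 + size b1).+1 in
      let b2 := compile c2 l2 in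
      cmp_code M (x + 3) (y + 3) l M ++ [:: Jeq 0 0 l2] ++ b1
        ++ [:: Jeq 0 0 (l2 + size b2)] ++ b2
  | While x y c =>
      let l := p + 2 * M in
      let b := compile c l.+1 in
      cmp_code M (x + 3) (y + 3) l M ++ [:: Jeq 0 0 (l.+1 + size b).+1] ++ b
        ++ [:: Jeq 0 0 p]
  end.

Lemma compile_get x j y p : compile (Get x j y) p =
  cell_code j y p ++ read_code M (p + size (cell_code j y p)) (x + 3) 0 M.
Proof. by []. Qed.

Lemma compile_put x j y p : compile (Put j y x) p =
  cell_code j y p ++ write_code M (p + size (cell_code j y p)) (x + 3) 0 M.
Proof. by []. Qed.

Variables (S : nat) (P : program).

(* Number i of the input occupies the m words from m i on.  The arrays are
   interleaved, so that addresses need no product of variables, and start at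
   index base, beyond the input, as M is at least m. *)
Definition cell (j i : nat) : nat := M * n_arr * (base + i) + M * j.

Definition sim (s : state) (rg mm : nat -> nat) : Prop :=
  [/\ words_ok w rg, words_ok w mm,
      forall x, val_of w M rg (x + 3) = var s x,
      forall i, i < n_inp -> digits w mm (m * i) m = inp i &
      forall j i, j < n_arr -> digits w mm (cell j i) M = arr s j i].

Hypotheses (w_gt0 : 0 < w) (M_gt0 : 0 < M) (n_arr_gt0 : 0 < n_arr) (le_mM : m <= M).
Hypotheses (boundE : bound = 2 ^ (w * M)) (le_base : n_inp <= base).
Hypotheses (le_S : M * n_arr * (base + len) <= S) (lt_S : S < bound).

(** The dearest command is an array access: its address takes [M * n_arr + M * j] additions of
    [7 * M + 1] instructions each, up to a few more. The factor 100 is generous. *)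
Definition slowdown : nat := 100 * (M * M * n_arr.+1).

Lemma cell_lt j i : j < n_arr -> i < len -> cell j i + M <= S.
Proof.
move=> lt_j lt_i; apply: leq_trans le_S.
rewrite /cell -addnA -mulnSr -!mulnA -mulnDr leq_mul2l; apply/orP; right.
apply: (@leq_trans (n_arr * (base + i) + n_arr)); rewrite ?leq_add2l //.
by rewrite -mulnSr leq_mul2l; lia.
Qed.

(** The address of a word is a mixed-radix numeral with digits [base + i], [j] and [k], so dividing
    by [M] and then by [n_arr] recovers the cell. *)
Lemma cell_inj j i k j' i' k' : j < n_arr -> j' < n_arr -> k < M -> k' < M ->
  cell j i + k = cell j' i' + k' -> j = j' /\ i = i'.
Proof.
move=> lt_j lt_j' lt_k lt_k'; rewrite /cell -!mulnA -!mulnDr => E.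
have := congr1 (fun z => z %/ M) E.
rewrite !(mulnC M) !divnMDl // !divn_small // !addn0.
move=> {}E; have n_gt0 : 0 < n_arr by lia.
have := congr1 (fun z => z %/ n_arr) E.
rewrite !(mulnC n_arr) !divnMDl // !divn_small // !addn0.
by move=> /addnI eqi; subst i'; split=> //; move/addnI: E.
Qed.

Definition same_vars (rg rg' : nat -> nat) : Prop :=
  forall Y j, 2 < Y -> j < M -> rg' (reg M Y j) = rg (reg M Y j).

Lemma same_vars_val rg rg' Y : same_vars rg rg' -> 2 < Y ->
  val_of w M rg' Y = val_of w M rg Y.
Proof. by move=> fr lt_Y; apply: eq_digits => j lt_j; apply: fr. Qed.

Lemma sim_temp s rg rg' mm :
  sim s rg mm -> words_ok w rg' -> same_vars rg rg' -> sim s rg' mm.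
Proof.
case=> ok okm Ev Ei Ea ok' fr; split=> // x.
by rewrite (same_vars_val fr) //; lia.
Qed.

Lemma sim_set s rg rg' mm x v : sim s rg mm -> words_ok w rg' ->
  (forall Y j, 2 < Y -> Y != x + 3 -> j < M ->
    rg' (reg M Y j) = rg (reg M Y j)) ->
  val_of w M rg' (x + 3) = v -> sim (set_var s x v) rg' mm.
Proof.
case=> ok okm Ev Ei Ea ok' fr eqx; split=> // y /=.
case: eqP => [-> //|ny]; rewrite -Ev.
by apply: eq_digits => j lt_j; apply: fr; lia.
Qed.

Lemma size_set_code X b : size (set_code M X b) = M.
Proof. by rewrite size_map size_iota. Qed.

Lemma size_inp_code y p : size (inp_code y p) = M + m * (7 * M).+1 + M.
Proof. by rewrite /inp_code !size_cat !size_set_code size_rep_code addnA. Qed.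

Lemma size_cell_code j y p : size (cell_code j y p) =
  (7 * M).+1 + M + M * n_arr * (7 * M).+1 + M + M * j * (7 * M).+1.
Proof.
by rewrite /cell_code !size_cat !size_set_code !size_rep_code size_addc !addnA.
Qed.

Lemma reach_inp_code s rg mm y p T Q :
  sim s rg mm -> m * var s y < bound -> code_at P p (inp_code y p) ->
  (forall rg', words_ok w rg' -> same_vars rg rg' ->
     val_of w M rg' 0 = m * var s y -> val_of w M rg' 2 = 1 ->
     reach w S P (Config (p + size (inp_code y p)) rg' mm) T Q) ->
  reach w S P (Config p rg mm) (size (inp_code y p) + T) Q.
Proof.
move=> [ok okm Ev Ei Ea] lt_y code next; rewrite boundE in lt_y.
move: code; rewrite /inp_code => /code_at_cat [c1 /code_at_cat [c2 c3]].
rewrite size_set_code in c2 c3; rewrite size_rep_code in c3.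
rewrite size_inp_code -!addnA; apply: (reach_set w_gt0 M_gt0 _ ok c1) => //.
move=> rg1 ok1 fr1 eq1.
have E1 : val_of w M rg1 (y + 3) = var s y.
  by rewrite (same_but_val w fr1) ?Ev //; lia.
apply: (reach_rep w_gt0 _ ok1 _ c2); [lia | by rewrite eq1 E1 | ].
move=> rg2 ok2 fr2 eq2; apply: (reach_set w_gt0 M_gt0 _ ok2 c3) => //.
move=> rg3 ok3 fr3 eq3.
have -> : p + M + m * (7 * M).+1 + M = p + size (inp_code y p).
  by rewrite size_inp_code; lia.
apply: next => //.
  by move=> Y j lt_Y lt_j; rewrite fr3 ?fr2 ?fr1 //; lia.
by rewrite (same_but_val w fr3) // eq2 eq1 E1.
Qed.

Lemma reach_cell_code s rg mm j y p T Q :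
  sim s rg mm -> var s 0 = base -> j < n_arr -> var s y < len ->
  code_at P p (cell_code j y p) ->
  (forall rg', words_ok w rg' -> same_vars rg rg' ->
     val_of w M rg' 0 = cell j (var s y) -> val_of w M rg' 2 = 1 ->
     reach w S P (Config (p + size (cell_code j y p)) rg' mm) T Q) ->
  reach w S P (Config p rg mm) (size (cell_code j y p) + T) Q.
Proof.
move=> [ok okm Ev Ei Ea] Eb lt_j lt_y code next.
have := cell_lt lt_j lt_y; rewrite /cell => lt_c.
have le_b : base + var s y <= M * n_arr * (base + var s y).
  by rewrite leq_pmull // muln_gt0 M_gt0; lia.
have lt_S' := lt_S; rewrite boundE in lt_S'.
move: code; rewrite /cell_code.
move=> /code_at_cat [c1 /code_at_cat [c2 /code_at_cat [c3 /code_at_cat [c4 c5]]]].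
rewrite !(size_set_code, size_rep_code, size_addc) in c2 c3 c4 c5.
rewrite size_cell_code -!addnA; apply: (reach_add w_gt0 ok _ c1).
  by rewrite Ev -[3]/(0 + 3) Ev Eb; lia.
move=> rg1 ok1 fr1; rewrite Ev -[3]/(0 + 3) Ev Eb => eq1.
apply: (reach_set w_gt0 M_gt0 _ ok1 c2) => // rg2 ok2 fr2 eq2.
have E2 : val_of w M rg2 1 = base + var s y by rewrite (same_but_val w fr2).
apply: (reach_rep w_gt0 _ ok2 _ c3); [lia | rewrite eq2 E2; lia | ].
move=> rg3 ok3 fr3; rewrite eq2 E2 add0n => eq3.
apply: (reach_set w_gt0 M_gt0 _ ok3 c4) => // rg4 ok4 fr4 eq4.
have E4 : val_of w M rg4 0 = M * n_arr * (base + var s y).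
  by rewrite (same_but_val w fr4).
apply: (reach_rep w_gt0 _ ok4 _ c5); [lia | rewrite eq4 E4; lia | ].
move=> rg5 ok5 fr5; rewrite eq4 E4 muln1 => eq5.
set q := (p in Config p).
have -> : q = p + size (cell_code j y p) by rewrite size_cell_code /q; lia.
apply: next => //; last by rewrite (same_but_val w fr5).
by move=> Y k lt_Y lt_k; rewrite fr5 ?fr4 ?fr3 ?fr2 ?fr1 //; lia.
Qed.

Lemma sim_write s rg mm mm' j i x : sim s rg mm -> words_ok w mm' ->
  j < n_arr ->
  (forall b, ~~ (cell j i <= b < cell j i + M) -> mm' b = mm b) ->
  (forall k, k < M -> mm' (cell j i + k) = rg (reg M (x + 3) k)) ->
  sim (set_arr s j i (var s x)) rg mm'.
Proof.
case=> ok okm Ev Ei Ea okm' lt_j out inn; split=> //.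
- move=> l lt_l; rewrite -Ei //; apply: eq_digits => k lt_k; apply: out.
  (* The input ends at [m * n_inp], which is at most [M * n_arr * base], where the arrays begin. *)
  have le1 : k < m * l.+1 by rewrite mulnS; lia.
  have le2 : m * l.+1 <= cell j i.
    rewrite /cell -mulnA; apply: leq_trans (leq_addr _ _).
    apply: leq_mul => //; apply: (@leq_trans base); first by lia.
    by apply: leq_trans (leq_addr i base) _; rewrite leq_pmull //; lia.
  by lia.
- move=> k l lt_k /=; case: eqP => [->|nj]; rewrite /update; first case: eqP => [->|ni].
  + by rewrite -Ev -[cell j i]addn0 digits_shift; apply: eq_digits => o lt_o; apply: inn.
  + rewrite -Ea //; apply: eq_digits => o lt_o; apply: out.
    apply/negP => lt_c; case: (@cell_inj j l (o - cell j l) j i (o - cell j i)); lia.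
  rewrite -Ea //; apply: eq_digits => o lt_o; apply: out.
  apply/negP => lt_c; case: (@cell_inj k l (o - cell k l) j i (o - cell j i)); lia.
Qed.

(** The induction is on the evaluation and not on the command, so that the later rounds of a loop
    are covered by the hypothesis for the same code at the same position. *)
Lemma compile_correct c s t s' : ev c s t s' ->
  forall p rg mm T Q, code_at P p (compile c p) -> sim s rg mm ->
  (forall rg' mm', sim s' rg' mm' ->
     reach w S P (Config (p + size (compile c p)) rg' mm') T Q) ->
  reach w S P (Config p rg mm) (slowdown * t + T) Q.
Proof.
elim=> {c s t s'}.
- move=> s p rg mm T Q _ sm next.
  by have := next _ _ sm; rewrite addn0 muln0; apply.
- move=> s x b p rg mm T Q /= code sm next.
  have ok : words_ok w rg by case: sm.
  apply: (@reach_weaken _ _ _ _ (M + T) _ Q) => //; last first.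
    by rewrite /slowdown; nia.
  apply: (reach_set w_gt0 M_gt0 (leq_b1 b) ok code) => rg' ok' fr eqx.
  rewrite size_set_code in next; apply: next.
  by apply: (sim_set sm) => // Y j _; apply: fr.
- move=> s x y z lt_b p rg mm T Q code sm next.
  have ok : words_ok w rg by case: sm.
  apply: (@reach_weaken _ _ _ _ ((7 * M).+1 + T) _ Q) => //; last first.
    by rewrite /slowdown; nia.
  case: (sm) => _ _ Ev _ _; apply: (reach_add w_gt0 ok _ code).
    by rewrite !Ev -boundE.
  move=> rg' ok' fr; rewrite !Ev => eqx.
  rewrite size_addc in next; apply: next.
  by apply: (sim_set sm) => // Y j _; apply: fr.
- move=> s x y lt_y p rg mm T Q; rewrite [compile _ _]/= => code sm next.
  have lt_b : m * var s y + m <= S.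
    apply: leq_trans le_S; rewrite -mulnSr -mulnA; apply: leq_mul => //.
    have le1 : (var s y).+1 <= base + len by lia.
    by apply: leq_trans le1 _; rewrite leq_pmull.
  move: code => /code_at_cat [c1 /code_at_cat [c2 c3]].
  rewrite !size_set_code in c2 c3.
  rewrite (size_cat (inp_code y p)) (size_cat (set_code M (x + 3) 0)) in next.
  rewrite size_set_code size_read_code in next.
  apply: (@reach_weaken _ _ _ _
    (size (inp_code y p) + (M + (m * (7 * M).+2 + T))) _ Q) => //; last first.
    by rewrite /slowdown size_inp_code; nia.
  apply: (reach_inp_code sm _ c1); first by lia.
  move=> rg1 ok1 fr1 eq1 one1.
  apply: (reach_set w_gt0 M_gt0 _ ok1 c2) => // rg2 ok2 fr2 eq2.
  have E0 : val_of w M rg2 0 = m * var s y by rewrite (same_but_val w fr2) //; lia.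
  have okm : words_ok w mm by case: sm.
  apply: (reach_read_code w_gt0 _ ok2 okm _ _ _ _ c3); rewrite ?E0.
  + lia.
  + lia.
  + by rewrite (same_but_val w fr2) //; lia.
  + by rewrite -boundE; lia.
  + lia.
  move=> rg3 ok3 fr3 eq3; rewrite !addnA in next *; apply: next.
  apply: (sim_set sm) => //.
    move=> Y k lt_Y nY lt_k; rewrite fr3 ?fr2 ?fr1 //; first by lia.
    by move=> eY; rewrite eY eqxx in nY.
  case: sm => _ _ Ev Ei _; rewrite -Ei // -[m * _]addn0 digits_shift.
  (* An input number fills only the [m] low words of the variable; the others are 0 because the
     variable was cleared before reading. *)
  have top0 : digits w (fun k => rg3 (reg M (x + 3) k)) m (M - m) = 0.
    apply: digits0 => k lt_k; rewrite fr3; [|lia..].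
    by apply: (digits_eq0 eq2); lia.
  have -> : val_of w M rg3 (x + 3) =
      digits w (fun k => rg3 (reg M (x + 3) k)) 0 (m + (M - m)).
    by rewrite subnKC.
  rewrite digitsD top0 muln0 addn0.
  by apply: eq_digits => k lt_k; rewrite -eq3.
- move=> s x j y Eb lt_j lt_y p rg mm T Q; rewrite compile_get => code sm next.
  have lt_c := cell_lt lt_j lt_y.
  move: code => /code_at_cat [c1 c2].
  rewrite (size_cat (cell_code j y p)) size_read_code in next.
  apply: (@reach_weaken _ _ _ _
    (size (cell_code j y p) + (M * (7 * M).+2 + T)) _ Q) => //; last first.
    by rewrite /slowdown size_cell_code; nia.
  apply: (reach_cell_code sm Eb lt_j lt_y c1).
  move=> rg1 ok1 fr1 eq1 one1.
  have okm : words_ok w mm by case: sm.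
  apply: (reach_read_code w_gt0 _ ok1 okm _ one1 _ _ c2); rewrite ?eq1.
  + lia.
  + lia.
  + by rewrite -boundE; lia.
  + lia.
  move=> rg3 ok3 fr3 eq3; rewrite !addnA in next *; apply: next.
  apply: (sim_set sm) => //.
    move=> Y k lt_Y nY lt_k; rewrite fr3 ?fr1 //; first by lia.
    by move=> eY; rewrite eY eqxx in nY.
  case: sm => _ _ Ev _ Ea; rewrite -Ea // -[cell _ _]addn0 digits_shift.
  by apply: eq_digits => k lt_k; rewrite -eq3.
- move=> s x j y Eb lt_j lt_y p rg mm T Q; rewrite compile_put => code sm next.
  have lt_c := cell_lt lt_j lt_y.
  move: code => /code_at_cat [c1 c2].
  rewrite (size_cat (cell_code j y p)) size_write_code in next.
  apply: (@reach_weaken _ _ _ _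
    (size (cell_code j y p) + (M * (7 * M).+2 + T)) _ Q) => //; last first.
    by rewrite /slowdown size_cell_code; nia.
  apply: (reach_cell_code sm Eb lt_j lt_y c1).
  move=> rg1 ok1 fr1 eq1 one1.
  have okm : words_ok w mm by case: sm.
  apply: (reach_write_code w_gt0 _ ok1 okm _ one1 _ _ c2); rewrite ?eq1.
  + lia.
  + lia.
  + by rewrite -boundE; lia.
  + lia.
  move=> rg2 mm2 ok2 okm2 fr2 out2 in2; rewrite !addnA in next *; apply: next.
  apply: (@sim_write _ _ mm); [|by []|by []|by []|].
    apply: (sim_temp (sim_temp sm ok1 fr1) ok2) => Y k lt_Y lt_k.
    by rewrite fr2 //; lia.
  by move=> k lt_k; rewrite in2 // fr2 //; lia.
- move=> s c1 c2 t1 t2 s1 s2 _ IH1 _ IH2 p rg mm T Q.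
  rewrite [compile _ _]/= => /code_at_cat [code1 code2] sm next.
  rewrite mulnDr -addnA; apply: (IH1 _ _ _ _ _ code1 sm) => rg1 mm1 sm1.
  apply: (IH2 _ _ _ _ _ code2 sm1) => rg2 mm2 sm2.
  by rewrite -addnA -size_cat; apply: next.
- move=> s x y c1 c2 t s' lt_xy _ IH p rg mm T Q.
  rewrite [compile _ _]/=; set l := p + 2 * M; set b1 := compile c1 _.
  set l2 := (l.+1 + size b1).+1; set b2 := compile c2 _.
  move=> /code_at_cat [code1]; rewrite size_cmp_code -/l.
  move=> [E /code_at_cat [code2 [E2 _]]] sm next.
  have [ok _ Ev _ _] := sm.
  apply: (@reach_weaken _ _ _ _ (2 * M + (slowdown * t + T.+1)) _ Q) => //; last first.
    by rewrite mulnS /slowdown; nia.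
  apply: (reach_cmp w_gt0 ok _ code1) => //; rewrite !Ev lt_xy.
  apply: (IH _ _ _ _ _ code2 sm) => rg1 mm1 sm1.
  apply: (reach_jeq E2); rewrite eqxx.
  move: next; rewrite !(size_cat, size_cmp_code) /= size_cat /=.
  have -> : p + (2 * M + (size b1 + (size b2).+1).+1) = l2 + size b2.
    by rewrite /l2 /l; lia.
  exact.
- move=> s x y c1 c2 t s' le_yx _ IH p rg mm T Q.
  rewrite [compile _ _]/=; set l := p + 2 * M; set b1 := compile c1 _.
  set l2 := (l.+1 + size b1).+1; set b2 := compile c2 _.
  move=> /code_at_cat [code1]; rewrite size_cmp_code -/l.
  move=> [E /code_at_cat [_ [_ code2]]] sm next.
  have [ok _ Ev _ _] := sm.
  apply: (@reach_weaken _ _ _ _ (2 * M + (slowdown * t + T).+1) _ Q) => //; last first.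
    by rewrite mulnS /slowdown; nia.
  apply: (reach_cmp w_gt0 ok _ code1) => //; rewrite !Ev ltnNge le_yx.
  apply: (reach_jeq E); rewrite eqxx.
  apply: (IH _ _ _ _ _ code2 sm) => rg1 mm1 sm1.
  move: next; rewrite !(size_cat, size_cmp_code) /= size_cat /=.
  have -> : p + (2 * M + (size b1 + (size b2).+1).+1) = l2 + size b2.
    by rewrite /l2 /l; lia.
  exact.
- move=> s x y c le_yx p rg mm T Q.
  rewrite [compile _ _]/=; set l := p + 2 * M; set b := compile c _.
  move=> /code_at_cat [code1]; rewrite size_cmp_code -/l => -[E _] sm next.
  have [ok _ Ev _ _] := sm.
  apply: (@reach_weaken _ _ _ _ (2 * M + T.+1) _ Q) => //; last first.
    by rewrite /slowdown; nia.
  apply: (reach_cmp w_gt0 ok _ code1) => //; rewrite !Ev ltnNge le_yx.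
  apply: (reach_jeq E); rewrite eqxx.
  have := next rg mm sm; rewrite !(size_cat, size_cmp_code) /= size_cat /=.
  have -> // : p + (2 * M + (size b + 1).+1) = (l.+1 + size b).+1.
  by rewrite /l; lia.
- move=> s x y c t1 t2 s1 s2 lt_xy _ IH1 _ IH2 p rg mm T Q code sm next.
  have := code; rewrite [compile _ _]/=; set l := p + 2 * M; set b := compile c _.
  move=> /code_at_cat [code1]; rewrite size_cmp_code -/l.
  move=> [E /code_at_cat [code2 [E2 _]]].
  have [ok _ Ev _ _] := sm.
  apply: (@reach_weaken _ _ _ _
    (2 * M + (slowdown * t1 + (slowdown * t2 + T).+1)) _ Q) => //; last first.
    by rewrite mulnS mulnDr /slowdown; nia.
  apply: (reach_cmp w_gt0 ok _ code1) => //; rewrite !Ev lt_xy.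
  apply: (IH1 _ _ _ _ _ code2 sm) => rg1 mm1 sm1.
  apply: (reach_jeq E2); rewrite eqxx.
  exact: (IH2 _ _ _ _ _ code sm1).
Qed.

End Compilation.

End Language.

(** * Walks and isomorphisms *)

Section Walks.

Variables (par col : nat -> nat) (T : nat).

(** Nodes are numbered in the order of discovery, node 0 being the root; [par] gives the parent and
    [col] the label of the arc from it. *)
Definition tree := forall t, 0 < t < T -> par t < t.

Definition traced (G : nat -> nat -> nat) (f : nat -> nat) :=
  forall t, 0 < t < T -> f t = G (col t) (f (par t)).

(* q is fuel: par t < t in a tree, so that q = t suffices *)
Fixpoint walk_rec (G : nat -> nat -> nat) (z q t : nat) : nat :=
  if q is q'.+1 then
    if t == 0 then z else G (col t) (walk_rec G z q' (par t))
  else z.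

Definition walk G z t := walk_rec G z t t.

(** This is the property by which the sets are split: one of the two walks from [z] is the tree path
    to node [t], the other is the tree path to node [h] followed by an arc [k]. *)
Definition closes G h k t z := walk G z t == G k (walk G z h).

Lemma traced_walk G f t : tree -> traced G f -> t < T -> f t = walk G (f 0) t.
Proof.
move=> tr_par tr_f; rewrite /walk; move: {2 5}t (leqnn t) => q.
elim: q t => [|q IH] t le_t lt_t /=; first by case: t le_t {lt_t}.
case: (t =P 0) => [-> //|nt]; have pos_t : 0 < t < T by lia.
have := tr_par t pos_t => lt_p; rewrite (tr_f t pos_t) -IH //; lia.
Qed.

End Walks.

Section Isomorphism.

Variables (n : nat) (offs : pred nat) (A B : nat -> nat -> nat).

Definition stable (G : nat -> nat -> nat) :=
  forall k v, offs k -> v < n -> G k v < n.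

(** Strong connectivity in the form of an induction principle on vertices, which avoids any mention
    of paths. *)
Definition connected (G : nat -> nat -> nat) := forall U : nat -> Prop,
  (exists2 v, v < n & U v) ->
  (forall k v, offs k -> v < n -> U v -> U (G k v)) -> forall v, v < n -> U v.

Definition graph_iso (f : nat -> nat) :=
  [/\ forall v, v < n -> f v < n,
      forall v v', v < n -> v' < n -> f v = f v' -> v = v' &
      forall k v, offs k -> v < n -> f (A k v) = B k (f v)].

Hypotheses (stA : stable A) (stB : stable B).
Hypotheses (conA : connected A) (conB : connected B).

Lemma walk_stable G par col z q t : stable G -> z < n -> tree par q ->
  (forall i, 0 < i < q -> offs (col i)) -> t < q -> walk par col G z t < n.
Proof.
move=> stG lt_z tr_par ok_col; rewrite /walk; move: {2 4}t (leqnn t) => r.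
elim: r t => [|r IH] t le_t lt_t //=.
case: (t =P 0) => // nt; have pos_t : 0 < t < q by lia.
by apply: stG; [apply: ok_col | have := tr_par t pos_t => ?; apply: IH; lia].
Qed.

(** Applying [f] to the ends of the walks from [z] labels the tree along arcs of the second graph,
    and by [traced_walk] such a labelling is determined by its root. *)
Lemma walk_iso f par col z q t : graph_iso f -> z < n -> tree par q ->
  (forall i, 0 < i < q -> offs (col i)) -> t < q ->
  f (walk par col A z t) = walk par col B (f z) t.
Proof.
case=> _ _ homf lt_z tr_par ok_col lt_t.
have tr_f : traced par col q B (fun i => f (walk par col A z i)).
  have tr_A : traced par col q A (walk par col A z).
    elim/ltn_ind=> i IH lt_i; rewrite {1}/walk; case: i lt_i IH => // i lt_i IH /=.
    congr (A _ _); rewrite /walk.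
    (* Unfolding [walk] leaves the parent with more fuel than its own number; surplus fuel does not
       change the value. *)
    have fuel r s : s <= r -> s <= i -> walk_rec par col A z r s = walk par col A z s.
      elim/ltn_ind: s r => s IHs r le_s le_i.
      case: r le_s => [|r] le_s; first by case: s le_s {IHs le_i}.
      case: s IHs le_s le_i => // s IHs le_s le_i; rewrite /walk /=.
      have lt_p : par s.+1 < s.+1 by apply: tr_par; lia.
      by congr (A _ _); rewrite (IHs _ lt_p r) ?(IHs _ lt_p s) //; lia.
    by rewrite fuel //; have := tr_par i.+1; lia.
  move=> i lt_i; rewrite {1}tr_A // homf //; first by apply: ok_col.
  by apply: (@walk_stable _ _ _ _ q) => //; have := tr_par i lt_i; lia.
by rewrite (traced_walk tr_par tr_f lt_t).
Qed.

Section Splitting.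

Variables (f par col : nat -> nat) (q h k t : nat).
Hypotheses (iso_f : graph_iso f) (tr_par : tree par q).
Hypothesis ok_col : forall i, 0 < i < q -> offs (col i).
Hypotheses (lt_h : h < q) (lt_t : t < q) (ok_k : offs k).

Lemma closes_iso z : z < n ->
  closes par col B h k t (f z) = closes par col A h k t z.
Proof.
move=> lt_z; have [_ inj_f hom_f] := iso_f.
have st i : i < q -> walk par col A z i < n by apply: walk_stable.
rewrite /closes -!(walk_iso iso_f lt_z tr_par ok_col) // -hom_f ?st //.
apply/eqP/eqP => [|-> //]; apply: inj_f; first exact: st.
by apply: stA => //; apply: st.
Qed.

Variables (X Y : seq nat).
Hypotheses (okX : all (gtn n) X) (eqXY : perm_eq (map f X) Y).

Lemma split_iso (b : bool) :
  perm_eq (map f (filter (fun z => closes par col A h k t z == b) X))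
          (filter (fun z => closes par col B h k t z == b) Y).
Proof.
have eqf : map f (filter (fun z => closes par col A h k t z == b) X) =
           filter (fun z => closes par col B h k t z == b) (map f X).
  rewrite filter_map; congr map; apply: eq_in_filter => z /(allP okX) lt_z /=.
  by rewrite closes_iso.
rewrite eqf; exact: perm_filter.
Qed.

End Splitting.

(** The listed vertices are closed under arcs, so they are all vertices, and sending each to its
    image is a homomorphism. Its range is closed under the arcs of the second graph, so it is
    surjective by [conB], and injective by finiteness. *)
Lemma search_iso (Q img pos : nat -> nat) T :
  0 < T ->
  (forall t, t < T -> [/\ Q t < n, img t < n & pos (Q t) = t]) ->
  (forall t k, t < T -> offs k -> let v := A k (Q t) in
     [/\ pos v < T, Q (pos v) = v & img (pos v) = B k (img t)]) ->
  exists f, graph_iso f.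
Proof.
move=> T_gt0 okQ closed.
have vis v : v < n -> pos v < T /\ Q (pos v) = v.
  move: v; apply: conA => [|k v ok_k lt_v [lt_p eq_v]].
    have [lt_Q _ pQ] := okQ 0 T_gt0.
    by exists (Q 0); rewrite // pQ.
  by have := closed _ _ lt_p ok_k; rewrite /= eq_v => -[].
pose f v := img (pos v).
have hom_f k v : offs k -> v < n -> f (A k v) = B k (f v).
  move=> ok_k lt_v; have [lt_p eq_v] := vis v lt_v.
  by have := closed _ _ lt_p ok_k; rewrite /= eq_v => -[].
have lt_f v : v < n -> f v < n by move=> /vis[/okQ[]].
have sur_f v : v < n -> exists2 u, u < n & f u = v.
  move: v; apply: conB => [|k v ok_k lt_v [u lt_u <-]].
    have [lt_Q lt_i pQ] := okQ 0 T_gt0.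
    by exists (img 0) => //; exists (Q 0); rewrite // /f pQ.
  by exists (A k u); [exact: stA | exact: hom_f].
exists f; split=> // v v' lt_v lt_v' eq_f.
(* A list of n entries that covers n values has no repetition. *)
have uniq_f : uniq (map f (iota 0 n)).
  apply: (@leq_size_uniq _ (iota 0 n)); rewrite ?iota_uniq ?size_map ?size_iota //.
  move=> y; rewrite mem_iota /= add0n => /sur_f[u lt_u <-].
  by apply: map_f; rewrite mem_iota.
have := nth_uniq 0 _ _ uniq_f; rewrite size_map size_iota => /(_ v v' lt_v lt_v').
by rewrite !(nth_map 0) ?size_iota // !nth_iota // eq_f eqxx => /esym/eqP.
Qed.

End Isomorphism.

(** Each failed search lowers the logarithm of the size by at least 1; this bounds the number of
    searches. *)
Lemma trunc_log_half s s' : 0 < s' -> s'.*2 <= s ->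
  (trunc_log 2 s').+1 <= trunc_log 2 s.
Proof. by move=> s'_gt0 le_s; rewrite -trunc_log2_double // leq_trunc_log. Qed.

(** * Running times of structured programs *)

Fixpoint wvars (c : cmd) : seq nat :=
  match c with
  | Skip | Put _ _ _ => [::]
  | Cst x _ | Add x _ _ | Inp x _ | Get x _ _ => [:: x]
  | Seq c1 c2 | If _ _ c1 c2 => wvars c1 ++ wvars c2
  | While _ _ c => wvars c
  end.

Fixpoint warrs (c : cmd) : seq nat :=
  match c with
  | Put j _ _ => [:: j]
  | Seq c1 c2 | If _ _ c1 c2 => warrs c1 ++ warrs c2
  | While _ _ c => warrs c
  | _ => [::]
  end.

Definition frame (c : cmd) (s s' : state) : Prop :=
  (forall x, x \notin wvars c -> var s' x = var s x) /\
  (forall j, j \notin warrs c -> arr s' j = arr s j).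

Lemma frame_trans c s1 s2 s3 : frame c s1 s2 -> frame c s2 s3 -> frame c s1 s3.
Proof.
by case=> v1 a1 [v2 a2]; split=> [x nx|j nj]; rewrite ?v2 ?v1 ?a2 ?a1.
Qed.

Lemma frame_cat c c1 c2 s s' : frame c s s' ->
  {subset wvars c <= wvars c1 ++ wvars c2} ->
  {subset warrs c <= warrs c1 ++ warrs c2} -> frame (Seq c1 c2) s s'.
Proof.
move=> [fv fa] sv sa; split=> [x|j] /= h; [apply: fv | apply: fa].
  by apply: contra h => /sv.
by apply: contra h => /sa.
Qed.

Definition block_of (l : seq cmd) : cmd := foldr Seq Skip l.

Definition if_neq (x y : nat) (c1 c2 : cmd) : cmd := If x y c1 (If y x c1 c2).

Section Rules.

Variables (bound n_inp : nat) (inp : nat -> nat) (base len n_arr : nat).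

Local Notation ev := (ev bound n_inp inp base len n_arr).

Lemma ev_frame c s t s' : ev c s t s' -> frame c s s'.
Proof.
elim=> {c s t s'} //=.
- by move=> s x b; split=> //= y; rewrite inE => /negPf ->.
- by move=> s x y z _; split=> //= u; rewrite inE => /negPf ->.
- by move=> s x y _; split=> //= u; rewrite inE => /negPf ->.
- by move=> s x j y _ _ _; split=> //= u; rewrite inE => /negPf ->.
- move=> s x j y _ _ _; split=> //= k; rewrite inE => /negPf nk.
  by rewrite nk.
- move=> s c1 c2 t1 t2 s1 s2 _ f1 _ f2; apply: (@frame_trans _ _ s1).
    by apply: (frame_cat f1) => x; rewrite mem_cat => ->.
  by apply: (frame_cat f2) => x; rewrite mem_cat orbC => ->.
- move=> s x y c1 c2 t s' _ _ f1.
  by apply: (@frame_cat c1) => // z; rewrite mem_cat => ->.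
- move=> s x y c1 c2 t s' _ _ f1.
  by apply: (@frame_cat c2) => // z; rewrite mem_cat orbC => ->.
by move=> s x y c t1 t2 s1 s2 _ _ f1 _ f2; apply: frame_trans f1 f2.
Qed.

Definition runs (c : cmd) (s : state) (T : nat) (Q : state -> Prop) : Prop :=
  exists t s', [/\ ev c s t s', t <= T & Q s'].

Lemma run_weaken c s T T' (Q Q' : state -> Prop) : runs c s T Q -> T <= T' ->
  (forall s', Q s' -> Q' s') -> runs c s T' Q'.
Proof.
move=> [t [s' [e le_t q]]] le_T sub; exists t, s'; split=> //; last exact: sub.
exact: leq_trans le_T.
Qed.

Lemma run_le c s T T' Q : runs c s T Q -> T <= T' -> runs c s T' Q.
Proof. by move=> r le_T; apply: run_weaken r le_T _. Qed.

Lemma run_frame c s T Q :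
  runs c s T Q -> runs c s T (fun s' => Q s' /\ frame c s s').
Proof.
by move=> [t [s' [e le_t q]]]; exists t, s'; split=> //; split=> //; apply: ev_frame e.
Qed.

Lemma run_nil s (Q : state -> Prop) : Q s -> runs (block_of [::]) s 0 Q.
Proof. by move=> q; exists 0, s; split=> //; apply: ev_skip. Qed.

Lemma run_seq c l s T1 T2 (Q1 Q : state -> Prop) : runs c s T1 Q1 ->
  (forall s', Q1 s' -> frame c s s' -> runs (block_of l) s' T2 Q) ->
  runs (block_of (c :: l)) s (T1 + T2) Q.
Proof.
move=> [t [s' [e le_t q]]] /(_ s' q (ev_frame e)) [t' [s'' [e' le_t' q']]].
by exists (t + t'), s''; split=> //; [apply: ev_seq e e' | apply: leq_add].
Qed.

Lemma run_bind c l s T1 T2 Q :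
  runs c s T1 (fun s' => runs (block_of l) s' T2 Q) ->
  runs (block_of (c :: l)) s (T1 + T2) Q.
Proof. by move/run_seq; apply. Qed.

Section Steps.

Variables (l : seq cmd) (s : state) (T : nat) (Q : state -> Prop).

Lemma run_cst x (b : bool) : runs (block_of l) (set_var s x b) T Q ->
  runs (block_of (Cst x b :: l)) s T.+1 Q.
Proof.
case=> t [s' [e le_t q]]; exists (1 + t), s'; split=> //.
by apply: ev_seq e; exact: ev_cst.
Qed.

Lemma run_add x y z : var s y + var s z < bound ->
  runs (block_of l) (set_var s x (var s y + var s z)) T Q ->
  runs (block_of (Add x y z :: l)) s T.+1 Q.
Proof.
move=> lt_b [t [s' [e le_t q]]]; exists (1 + t), s'; split=> //.
by apply: ev_seq e; exact: ev_add.
Qed.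

Lemma run_inp x y : var s y < n_inp ->
  runs (block_of l) (set_var s x (inp (var s y))) T Q ->
  runs (block_of (Inp x y :: l)) s T.+1 Q.
Proof.
move=> lt_b [t [s' [e le_t q]]]; exists (1 + t), s'; split=> //.
by apply: ev_seq e; exact: ev_inp.
Qed.

Lemma run_get x j y : var s 0 = base -> j < n_arr -> var s y < len ->
  runs (block_of l) (set_var s x (arr s j (var s y))) T Q ->
  runs (block_of (Get x j y :: l)) s T.+1 Q.
Proof.
move=> e0 lt_j lt_b [t [s' [e le_t q]]]; exists (1 + t), s'; split=> //.
by apply: ev_seq e; exact: ev_get.
Qed.

Lemma run_put x j y : var s 0 = base -> j < n_arr -> var s y < len ->
  runs (block_of l) (set_arr s j (var s y) (var s x)) T Q ->
  runs (block_of (Put j y x :: l)) s T.+1 Q.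
Proof.
move=> e0 lt_j lt_b [t [s' [e le_t q]]]; exists (1 + t), s'; split=> //.
by apply: ev_seq e; exact: ev_put.
Qed.

End Steps.

Lemma run_if x y c1 c2 s T Q :
  (var s x < var s y -> runs c1 s T Q) -> (var s y <= var s x -> runs c2 s T Q) ->
  runs (If x y c1 c2) s T.+1 Q.
Proof.
move=> h1 h2; case: (ltnP (var s x) (var s y)) => [lt|le].
  by have [t [s' [e le_t q]]] := h1 lt; exists t.+1, s'; split=> //; apply: ev_if_true.
by have [t [s' [e le_t q]]] := h2 le; exists t.+1, s'; split=> //; apply: ev_if_false.
Qed.

Lemma run_if_neq x y c1 c2 s T Q :
  (var s x <> var s y -> runs c1 s T Q) -> (var s x = var s y -> runs c2 s T Q) ->
  runs (if_neq x y c1 c2) s T.+2 Q.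
Proof.
move=> h1 h2; apply: run_if => [lt|le].
  by apply: run_le (h1 _) _ => //; lia.
by apply: run_if => ?; [apply: h1 | apply: h2]; lia.
Qed.

(** [f] is a potential: a round of cost [T] must lower it by more than [T], which also pays for the
    test, and the last test is the final 1. As [T] may vary from round to round, costs can be
    amortised. *)
Lemma run_while (I : state -> Prop) (f : state -> nat) x y c s0 :
  I s0 ->
  (forall s, I s -> frame c s0 s -> var s x < var s y ->
     exists T, runs c s T (fun s' => I s' /\ T + f s' < f s)) ->
  runs (While x y c) s0 (f s0).+1 (fun s => I s /\ var s y <= var s x).
Proof.
move=> I0 step; have [k le_k] := ubnP (f s0).
suff loop s : f s < k -> I s -> frame c s0 s ->
    runs (While x y c) s (f s).+1 (fun s' => I s' /\ var s' y <= var s' x).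
  by apply: loop.
elim: k {le_k} s => // k IH s le_k Is fr.
case: (ltnP (var s x) (var s y)) => [lt|le]; last first.
  by exists 1, s; split=> //; apply: ev_while_false.
have [T [t [s1 [e le_t [I1 lt_f]]]]] := step s Is fr lt.
have [||t' [s2 [e' le_t' q]]] := IH s1 _ I1; first by lia.
  exact: frame_trans fr (ev_frame e).
by exists (t + t').+1, s2; split=> //; [apply: ev_while_true e e' | lia].
Qed.

Lemma run_for (I : state -> Prop) x y c s0 K :
  I s0 ->
  (forall s, I s -> frame c s0 s -> var s x < var s y ->
     runs c s K
       (fun s' => I s' /\ var s' y - var s' x < var s y - var s x)) ->
  runs (While x y c) s0 ((var s0 y - var s0 x) * K.+1).+1
    (fun s => I s /\ var s y <= var s x).
Proof.
move=> I0 step; pose f s := (var s y - var s x) * K.+1.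
apply: (@run_while I f) => // s Is fr lt; exists K.
apply: (run_weaken (step s Is fr lt)) => // s' [I' lt']; split=> //.
by rewrite /f; nia.
Qed.

End Rules.

(** * The parallel search *)

Section Search.

Variables (n : nat) (offs : pred nat) (A B : nat -> nat -> nat).
Hypotheses (stA : stable n offs A) (stB : stable n offs B).

(* State of a search of the first graph from x: q lists the T vertices found,
   img their images under the only candidate for an isomorphism mapping x to
   y, and pos v is the position of v in q, or n if v has not been found. *)
Record search (x y T : nat) (pos q img par col : nat -> nat)
    (done : nat -> nat -> Prop) : Prop := Search {
  search_gt0 : 0 < T;
  search_root : q 0 = x /\ img 0 = y;
  search_list : forall t, t < T -> [/\ q t < n, img t < n & pos (q t) = t];
  search_pos : forall v, v < n -> pos v < n -> pos v < T /\ q (pos v) = v;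
  search_tree : forall t, 0 < t < T ->
    [/\ par t < t, offs (col t), q t = A (col t) (q (par t)) &
        img t = B (col t) (img (par t))];
  search_done : forall h k, done h k -> [/\ h < T, offs k & pos (A k (q h)) < n] }.

(** [bad] is a flag. If it is set, [h0], [k0] and [t0] record an arc between found vertices of the
    first graph whose counterpart does not join their images; they are the parameters of [closes]
    used for splitting. [done] is the set of arcs examined so far. *)
Record mismatch (bad h0 k0 t0 T : nat) (pos q img : nat -> nat)
    (done : nat -> nat -> Prop) : Prop := Mismatch {
  mismatch_none : bad = 0 -> forall h k, done h k ->
    img (pos (A k (q h))) = B k (img h);
  mismatch_some : 0 < bad ->
    [/\ h0 < T, t0 < T, offs k0, q t0 = A k0 (q h0) & img t0 <> B k0 (img h0)] }.

Lemma search_le x y T pos q img par col done :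
  search x y T pos q img par col done -> T <= n.
Proof.
case=> _ _ lst _ _ _; rewrite -(size_mkseq q T) -(size_iota 0 n).
apply: uniq_leq_size.
  by apply/mkseq_uniqP => i j /lst[_ _ pi] /lst[_ _ pj] e; rewrite -pi -pj e.
by move=> v /mapP[t]; rewrite !mem_iota => lt_t ->; have [] := lst t lt_t.
Qed.

(** A vertex not yet found can be added to the list without repetition. Hence a free cell remains
    whenever the search is about to write a new entry. *)
Lemma search_lt x y T pos q img par col done v :
  search x y T pos q img par col done -> v < n -> n <= pos v -> T < n.
Proof.
move=> S; have le_T := search_le S; case: S => _ _ lst _ _ _ lt_v le_p.
rewrite -(size_mkseq q T) -(size_iota 0 n).
have: uniq (v :: mkseq q T).
  rewrite cons_uniq; apply/andP; split.
    apply/mapP => -[t]; rewrite mem_iota => lt_t e.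
    by have [] := lst t lt_t; rewrite -e; lia.
  by apply/mkseq_uniqP => i j /lst[_ _ pi] /lst[_ _ pj] e; rewrite -pi -pj e.
move/(@uniq_leq_size _ _ (iota 0 n)); apply=> u; rewrite inE mem_iota.
by case/predU1P=> [-> //|/mapP[t]]; rewrite mem_iota => lt_t ->; have [] := lst t lt_t.
Qed.

Lemma search_start x y pos q img par col : x < n -> y < n -> 
  (forall v, v < n -> pos v = n) ->
  search x y 1 (update pos x 0) (update q 0 x) (update img 0 y) par col
    (fun _ _ => False).
Proof.
move=> lt_x lt_y none; rewrite /update; split=> //.
- by case=> // _; rewrite !eqxx.
- by move=> v lt_v; case: eqP => [-> //|_]; rewrite none // ltnn.
- by move=> t; lia.
Qed.

Lemma mismatch_start h k t T pos q img :
  mismatch 0 h k t T pos q img (fun _ _ => False).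
Proof. by []. Qed.

Section Step.

Variables (x y T : nat) (pos q img par col : nat -> nat).
Variables (done done' : nat -> nat -> Prop) (h k : nat).
Hypothesis S : search x y T pos q img par col done.
Hypotheses (lt_h : h < T) (ok_k : offs k).
Hypothesis doneE : forall h' k', done' h' k' -> done h' k' \/ (h' = h /\ k' = k).

Let u := A k (q h).
Let r := B k (img h).

Lemma search_seen : pos u < n -> search x y T pos q img par col done'.
Proof.
by case: S => ? ? ? ? ? dn lt_u; split=> // h' k' /doneE[/dn //|[-> ->]].
Qed.

Lemma mismatch_seen bad h0 k0 t0 : mismatch bad h0 k0 t0 T pos q img done ->
  img (pos u) = r -> mismatch bad h0 k0 t0 T pos q img done'.
Proof.
by case=> none some eq_r; split=> // /none nn h' k' /doneE[/nn|[-> ->]].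
Qed.

Lemma mismatch_found : pos u < n -> img (pos u) <> r ->
  mismatch 1 h k (pos u) T pos q img done'.
Proof.
move=> lt_u ne; split=> // _; have [lt_q _ _] := search_list S lt_h.
by have [|lt_p e] := search_pos S _ lt_u; first exact: stA.
Qed.

Lemma search_new : n <= pos u ->
  search x y T.+1 (update pos u T) (update q T u) (update img T r)
    (update par T h) (update col T k) done'.
Proof.
move=> le_p; have lt_u : u < n by apply: stA => //; have [] := search_list S lt_h.
have lt_T := search_lt S lt_u le_p.
have [lt_q lt_i _] := search_list S lt_h.
have lt_r : r < n by apply: stB.
case: S => T_gt0 [q0 i0] lst ps tr dn.
have neT t : t < T -> (t == T) = false by lia.
rewrite /update; split; rewrite ?neT //.
- move=> t le_t; case: eqP => [->|ne]; first by rewrite eqxx.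
  have lt_t : t < T by lia.
  have [lt1 lt2 pt] := lst t lt_t; split=> //.
  by case: eqP => // e; move: le_p; rewrite -e pt; lia.
- move=> v lt_v; case: (v =P u) => [-> _|_ lt_p]; first by rewrite eqxx.
  by have [lt1 e] := ps v lt_v lt_p; rewrite neT //; split=> //; lia.
- move=> t le_t; case: (t =P T) => [eT|ne].
    by rewrite eT (neT h) //; split.
  have lt_t : 0 < t < T by lia.
  have [lt1 ok e1 e2] := tr t lt_t; rewrite neT //; lia.
move=> h' k' /doneE[/dn[lt1 ok lt2]|[-> ->]].
  rewrite neT //; split=> //; first by lia.
  by case: (_ =P u).
by rewrite (neT h) // eqxx; split=> //; lia.
Qed.

Lemma mismatch_new bad h0 k0 t0 : mismatch bad h0 k0 t0 T pos q img done ->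
  n <= pos u ->
  mismatch bad h0 k0 t0 T.+1 (update pos u T) (update q T u) (update img T r) done'.
Proof.
case=> none some le_p.
have neT t : t < T -> (t == T) = false by lia.
rewrite /update; split.
  move=> /none nn h' k' /doneE[dn|[-> ->]]; last by rewrite !(neT h lt_h) !eqxx.
  have [lt1 ok lt2] := search_done S dn; rewrite !(neT h' lt1).
  (* Examined arcs end in vertices found earlier, so the new entry leaves their equations intact. *)
  case: (_ =P u) => [e|_]; first by move: lt2; rewrite e; lia.
  have [lt_q _ _] := search_list S lt1.
  have [|lt3 _] := search_pos S _ lt2; first exact: stA.
  by rewrite (neT _ lt3) nn.
case/some=> lt1 lt2 ok e ne; rewrite (neT h0 lt1) (neT t0 lt2); split=> //; lia.
Qed.

End Step.

Lemma search_weaken x y T pos q img par col (done done' : nat -> nat -> Prop) :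
  search x y T pos q img par col done -> (forall h k, done' h k -> done h k) ->
  search x y T pos q img par col done'.
Proof. by case=> ? ? ? ? ? dn sub; split=> // h k /sub /dn. Qed.

Lemma mismatch_weaken bad h0 k0 t0 T pos q img (done done' : nat -> nat -> Prop) :
  mismatch bad h0 k0 t0 T pos q img done -> (forall h k, done' h k -> done h k) ->
  mismatch bad h0 k0 t0 T pos q img done'.
Proof. by case=> none some sub; split=> // /none nn h k /sub /nn. Qed.

Lemma search_success x y T pos q img par col done h0 k0 t0 :
  connected n offs A -> connected n offs B ->
  search x y T pos q img par col done ->
  mismatch 0 h0 k0 t0 T pos q img done ->
  (forall h k, h < T -> offs k -> done h k) ->
  exists f, graph_iso n offs A B f.
Proof.
move=> cA cB S M all_done.
apply: (@search_iso n offs A B stA cA cB q img pos T (search_gt0 S) (search_list S)).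
move=> t k lt_t ok_k; have dn := all_done t k lt_t ok_k.
have [_ _ lt_p] := search_done S dn; have [lt_q _ _] := search_list S lt_t.
have [|lt1 e] := search_pos S _ lt_p; first exact: stA.
by split=> //; apply: (mismatch_none M).
Qed.

Lemma search_walk x y T pos q img par col done t :
  search x y T pos q img par col done -> t < T ->
  walk par col A x t = q t /\ walk par col B y t = img t.
Proof.
move=> S lt_t; have [q0 i0] := search_root S.
have tr : tree par T by move=> i /(search_tree S)[].
rewrite -q0 -i0; split; symmetry; apply: (@traced_walk _ _ T) => //;
  by move=> i /(search_tree S)[].
Qed.

(** The property holds at [x] and fails at [y]. This is why neither part of a split is empty once
    the parts of the two sets have matching sizes. *)
Lemma search_separates x y T pos q img par col done bad h0 k0 t0 :
  search x y T pos q img par col done ->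
  mismatch bad h0 k0 t0 T pos q img done -> 0 < bad ->
  [/\ h0 < T, t0 < T, offs k0, closes par col A h0 k0 t0 x &
      ~~ closes par col B h0 k0 t0 y].
Proof.
move=> S M /(mismatch_some M)[lt_h lt_t ok e ne]; split=> //; rewrite /closes.
  have [-> _] := search_walk S lt_h; have [-> _] := search_walk S lt_t.
  exact/eqP.
have [_ ->] := search_walk S lt_h; have [_ ->] := search_walk S lt_t.
exact/eqP.
Qed.

End Search.

(** * The algorithm *)

Local Notation x_base := 0.
Local Notation x_n := 1.
Local Notation x_d := 2.
Local Notation x_0 := 3.
Local Notation x_1 := 4.
Local Notation x_A := 5.
Local Notation x_B := 6.
Local Notation x_dn := 7.
Local Notation x_ans := 8.
Local Notation x_go := 9.
Local Notation x_s := 10.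
Local Notation x_i := 11.
Local Notation x_z := 12.
Local Notation x_T := 13.
Local Notation x_h := 14.
Local Notation x_q := 15.
Local Notation x_p := 16.
Local Notation x_k := 17.
Local Notation x_u := 18.
Local Notation x_r := 19.
Local Notation x_v := 20.
Local Notation x_bad := 21.
Local Notation x_h0 := 22.
Local Notation x_k0 := 23.
Local Notation x_t0 := 24.
Local Notation x_yes := 25.
Local Notation x_no := 26.
Local Notation x_t := 27.
Local Notation x_a := 28.
Local Notation x_c := 29.
Local Notation x_saved := 30.

Local Notation a_pos := 4.
Local Notation a_q := 5.
Local Notation a_img := 6.
Local Notation a_par := 7.
Local Notation a_col := 8.
Local Notation a_walk := 9.

(* b = true stands for the first graph, b = false for the second *)
Definition x_graph (b : bool) := if b then x_A else x_B.
Definition a_class (b : bool) := if b then 0 else 2.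
Definition a_rest (b : bool) := if b then 1 else 3.

(** [x_0] and [x_1] hold 0 and 1, so adding [x_0] copies a variable. As parents precede their
    children, a single pass over the tree finds the ends of all walks from [x_z]. *)
Definition walk_cmd (g : nat) : cmd := block_of
  [:: Put a_walk x_0 x_z; Add x_t x_1 x_0;
      While x_t x_T (block_of
        [:: Get x_a a_par x_t; Get x_a a_walk x_a; Get x_c a_col x_t;
            Add x_a x_a x_c; Add x_a x_a g; Inp x_a x_a;
            Put a_walk x_t x_a; Add x_t x_t x_1])].

(** Vertices with the property are compacted in place, the write index [x_yes] never overtaking the
    read index [x_i]; the others go to a second array. *)
Definition split_cmd (b : bool) : cmd := block_of
  [:: Cst x_yes false; Cst x_no false; Cst x_i false;
      While x_i x_s (block_of
        [:: Get x_z (a_class b) x_i; walk_cmd (x_graph b);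
            Get x_q a_walk x_t0; Get x_p a_walk x_h0; Add x_p x_p x_k0;
            Add x_p x_p (x_graph b); Inp x_p x_p;
            if_neq x_q x_p
              (block_of [:: Put (a_rest b) x_no x_z; Add x_no x_no x_1])
              (block_of [:: Put (a_class b) x_yes x_z; Add x_yes x_yes x_1]);
            Add x_i x_i x_1])].

Definition copy_cmd (b : bool) : cmd := block_of
  [:: Cst x_i false;
      While x_i x_no (block_of
        [:: Get x_z (a_rest b) x_i; Put (a_class b) x_i x_z;
            Add x_i x_i x_1])].

(* x_k is the offset of a permutation in its table, not its color.  A mismatch
   does not stop the search; a later one overwrites it. *)
Definition visit_cmd : cmd := block_of
  [:: Add x_u x_A x_k; Add x_u x_u x_q; Inp x_u x_u;
      Add x_r x_B x_k; Add x_r x_r x_p; Inp x_r x_r;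
      Get x_v a_pos x_u;
      If x_v x_n
        (block_of
          [:: Get x_a a_img x_v;
              if_neq x_a x_r
                (block_of [:: Cst x_bad true; Add x_h0 x_h x_0;
                              Add x_k0 x_k x_0; Add x_t0 x_v x_0])
                Skip])
        (block_of
          [:: Put a_q x_T x_u; Put a_img x_T x_r; Put a_par x_T x_h;
              Put a_col x_T x_k; Put a_pos x_u x_T; Add x_T x_T x_1]);
      Add x_k x_k x_n].

Definition search_cmd : cmd := block_of
  [:: Cst x_i false;
      While x_i x_n (block_of [:: Put a_pos x_i x_n; Add x_i x_i x_1]);
      Put a_q x_0 x_z; Put a_img x_0 x_q; Put a_pos x_z x_0;
      Cst x_T true; Cst x_h false; Cst x_bad false;
      While x_h x_T (block_of
        [:: Get x_q a_q x_h; Get x_p a_img x_h; Cst x_k false;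
            While x_k x_dn visit_cmd; Add x_h x_h x_1])].

(** Only the numbers of vertices with the property are compared: both sets have [x_s] elements, so
    the complements then agree in size too. The part with the property already stands in the class
    array; only the other one has to be copied there. *)
Definition round_cmd : cmd := block_of
  [:: Get x_z (a_class true) x_0; Get x_q (a_class false) x_0; search_cmd;
      If x_0 x_bad
        (block_of
          [:: split_cmd true; Add x_saved x_yes x_0; split_cmd false;
              if_neq x_saved x_yes
                (block_of [:: Cst x_ans false; Cst x_go false])
                (If x_no x_yes
                  (block_of [:: copy_cmd true; copy_cmd false; Add x_s x_no x_0])
                  (block_of [:: Add x_s x_yes x_0]))])
        (Cst x_go false)].

(* For n = 1 the time allowed does not depend on d, since log 1 = 0, and there
   is nothing to test. *)
Definition main_cmd : cmd := block_of
  [:: Cst x_0 false; Cst x_1 true; Inp x_n x_0; Inp x_d x_1; Cst x_ans true;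
      If x_1 x_n
        (block_of
          [:: Add x_A x_1 x_1; Cst x_dn false; Cst x_i false;
              While x_i x_d (block_of [:: Add x_dn x_dn x_n; Add x_i x_i x_1]);
              Add x_B x_A x_dn; Add x_base x_B x_dn;
              Cst x_i false;
              While x_i x_n (block_of
                [:: Put (a_class true) x_i x_i; Put (a_class false) x_i x_i;
                    Add x_i x_i x_1]);
              Add x_s x_n x_0; Cst x_go true;
              While x_0 x_go round_cmd])
        Skip].

(** Simplifying a state must leave the remaining commands in the form that the rules for [runs]
    match. *)
Arguments block_of : simpl never.

(** * Timed specifications of the commands on the graphs read from the input *)

Section Correctness.

Variables (n d bound : nat) (inp : nat -> nat).
Hypotheses (n_gt1 : 1 < n) (d_gt0 : 0 < d) (lt_bound : 4 + 4 * (d * n) < bound).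

Local Notation size2 := (2 + d * n + d * n).
Local Notation runs := (runs bound size2 inp size2 n 10).

Definition offs : pred nat := fun k => (k < d * n) && (n %| k).

Definition graph (b : bool) (k v : nat) : nat :=
  inp ((if b then 2 else 2 + d * n) + k + v).

Hypotheses (st : forall b, stable n offs (graph b)).
Hypotheses (con : forall b, connected n offs (graph b)).

Record env (s : state) : Prop := Env {
  env_base : var s x_base = size2; env_n : var s x_n = n;
  env_0 : var s x_0 = 0; env_1 : var s x_1 = 1;
  env_A : var s x_A = 2; env_B : var s x_B = 2 + d * n;
  env_dn : var s x_dn = d * n }.

Lemma env_frame c s s' :
  all (fun x => x \notin wvars c) [:: x_base; x_n; x_0; x_1; x_A; x_B; x_dn] ->
  frame c s s' -> env s -> env s'.
Proof.
move=> /= /and5P[h1 h2 h3 h4 /and4P[h5 h6 h7 _]] [fv _] [*].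
by split; rewrite fv.
Qed.

Lemma x_graph_neq b y : 6 < y -> (x_graph b == y) = false.
Proof. by move=> lt_y; case: b; apply/eqP => /=; lia. Qed.

Lemma le_dn : n <= d * n. Proof. by rewrite leq_pmull. Qed.

Lemma offs_lt k : offs k -> k < d * n. Proof. by case/andP. Qed.

Lemma offs_next k : offs k -> k + n <= d * n.
Proof.
case/andP=> lt_k /dvdnP[q ek]; rewrite ek -mulSnr leq_mul2r.
by move: lt_k; rewrite ek ltn_mul2r => /andP[_ ->]; rewrite orbT.
Qed.

Lemma run_walk b s T :
  env s -> var s x_T = T -> 0 < T <= n -> var s x_z < n ->
  tree (arr s a_par) T -> (forall t, 0 < t < T -> offs (arr s a_col t)) ->
  runs (walk_cmd (x_graph b)) s (20 * n)
    (fun s' => forall t, t < T ->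
      arr s' a_walk t = walk (arr s a_par) (arr s a_col) (graph b) (var s x_z) t).
Proof.
move=> E eT bT lt_z tr ok; have ledn := le_dn.
have [e0 e1 e2 e3 e4 e5 e6] := E.
rewrite /walk_cmd; eapply run_le.
  apply: run_put => /=; [lia..|]; rewrite e2.
  apply: run_add => /=; first by lia.
  rewrite e2 e3 /=.
  apply: run_seq.
    pose I s1 := [/\ 0 < var s1 x_t <= T, arr s1 a_walk 0 = var s x_z,
      (forall i, 0 < i < var s1 x_t -> arr s1 a_walk i =
         graph b (arr s a_col i) (arr s1 a_walk (arr s a_par i))) &
      (forall i, i < var s1 x_t -> arr s1 a_walk i < n)].
    apply: (@run_for _ _ _ _ _ _ I _ _ _ _ 8).
      by split=> //=; [lia | move=> i; lia | case].
    move=> s1 [bt w0 ws wn] fr lt.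
    have E1 : env s1.
      apply: env_frame fr _; first by case: (b).
      by split.
    have [f0 f1 f2 f3 f4 f5 f6] := E1.
    have eT1 : var s1 x_T = T by rewrite (proj1 fr) //; case: (b).
    have ep : arr s1 a_par = arr s a_par by rewrite (proj2 fr).
    have ec : arr s1 a_col = arr s a_col by rewrite (proj2 fr).
    rewrite eT1 in lt; have bt1 : 0 < var s1 x_t < T by lia.
    have lt_p := tr _ bt1; have lt_c := offs_next (ok _ bt1).
    have lt_w := wn _ lt_p.
    have gE : inp (arr s1 a_walk (arr s a_par (var s1 x_t)) + arr s a_col (var s1 x_t)
         + var s1 (x_graph b)) = graph b (arr s a_col (var s1 x_t))
                  (arr s1 a_walk (arr s a_par (var s1 x_t))).
      by rewrite /graph; congr inp; case: (b); rewrite /= ?f4 ?f5; lia.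
    have lt_g : var s1 (x_graph b) <= 2 + d * n by case: (b); rewrite /= ?f4 ?f5; lia.
    apply: run_get => /=; [by [] | by [] | lia | rewrite ep].
    apply: run_get => /=; [by [] | by [] | lia | ].
    apply: run_get => /=; [by [] | by [] | lia | rewrite ec].
    apply: run_add => /=; first by lia.
    apply: run_add => /=; rewrite !x_graph_neq //; first by lia.
    apply: run_inp => /=; first by lia.
    rewrite gE; apply: run_put => /=; [by [] | by [] | lia | ].
    apply: run_add => /=; first by lia.
    rewrite f3; apply: run_nil => /=; rewrite /I /=; split; last by lia.
    split=> //=; first by lia.
    - by rewrite /update; case: eqP => //; lia.
    - move=> i lt_i; rewrite /update; case: (i =P _) => [->|ne].
        by case: eqP => //; lia.
      case: eqP => [e|_]; last by apply: ws; lia.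
      by have := tr i; lia.
    move=> i lt_i; rewrite /update; case: eqP => [_|ne]; last by apply: wn; lia.
    by apply: st => //; apply: ok.
  move=> s1 [[bt w0 ws wn] le_T] fr; apply: run_nil => t lt_t.
  have eT1 : var s1 x_T = T.
    by rewrite (proj1 fr) //; case: (b).
  rewrite -w0; apply: (@traced_walk _ _ T) => //.
  by move=> i lt_i; apply: ws; lia.
rewrite /=; nia.
Qed.

Lemma run_split b s sz T h k t :
  env s -> var s x_s = sz -> sz <= n -> var s x_T = T -> 0 < T <= n ->
  var s x_h0 = h -> var s x_k0 = k -> var s x_t0 = t ->
  h < T -> t < T -> offs k ->
  tree (arr s a_par) T -> (forall t, 0 < t < T -> offs (arr s a_col t)) ->
  (forall i, i < sz -> arr s (a_class b) i < n) ->
  let X := mkseq (arr s (a_class b)) sz in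
  let sat c := fun z => closes (arr s a_par) (arr s a_col) (graph b) h k t z == c in
  runs (split_cmd b) s (50 * n * sz + 10)
    (fun s' => [/\ var s' x_yes = size (filter (sat true) X),
       var s' x_no = size (filter (sat false) X),
       mkseq (arr s' (a_class b)) (var s' x_yes) = filter (sat true) X &
       mkseq (arr s' (a_rest b)) (var s' x_no) = filter (sat false) X]).
Proof.
move=> E es le_s eT bT eh ek et lt_h lt_t ok_k tr ok lt_X X sat; have ledn := le_dn.
have nx : a_class b != a_rest b by case: (b).
have [na1 na2] : a_class b < 4 /\ a_rest b < 4 by case: (b).
have [e0 e1 e2 e3 e4 e5 e6] := E.
pose Xi i := mkseq (arr s (a_class b)) i.
rewrite /split_cmd; eapply run_le.
  do 3!apply: run_cst; apply: run_seq.
    (* The last clause keeps the unread cells of the class intact although the array is being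
       overwritten from the left. *)
    pose I s1 := [/\ var s1 x_i <= sz,
      [/\ var s1 x_yes = size (filter (sat true) (Xi (var s1 x_i))),
       var s1 x_no = size (filter (sat false) (Xi (var s1 x_i))),
       mkseq (arr s1 (a_class b)) (var s1 x_yes) = filter (sat true) (Xi (var s1 x_i)) &
       mkseq (arr s1 (a_rest b)) (var s1 x_no) = filter (sat false) (Xi (var s1 x_i))] &
      forall i, var s1 x_i <= i -> arr s1 (a_class b) i = arr s (a_class b) i].
    apply: (@run_for _ _ _ _ _ _ I _ _ _ _ (20 * n + 20)) => //.
    move=> s1 [le_i [ey en eX eU] eqX] fr lt.
    have E1 : env s1.
      apply: env_frame fr _; first by case: (b).
      by split.
    have [f0 f1 f2 f3 f4 f5 f6] := E1.
    have fv x : x \in [:: x_s; x_T; x_h0; x_k0; x_t0] -> var s1 x = var s x.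
      rewrite !inE => mem; rewrite (proj1 fr) /=.
        by repeat case/predU1P: mem => [-> //|mem]; rewrite (eqP mem).
      by case: (b); repeat case/predU1P: mem => [-> //|mem]; rewrite (eqP mem).
    have fa j : j \in [:: a_q; a_img; a_par; a_col] -> arr s1 j = arr s j.
      rewrite !inE => mem; rewrite (proj2 fr) //.
      by case: (b); repeat case/predU1P: mem => [-> //|mem]; rewrite (eqP mem).
    have es1 : var s1 x_s = sz by rewrite fv.
    rewrite es1 in lt.
    set z := arr s1 (a_class b) (var s1 x_i).
    have ez : z = arr s (a_class b) (var s1 x_i) by apply: eqX.
    have lt_z : z < n by rewrite ez; apply: lt_X.
    eapply run_le.
      apply: run_get => /=; [by [] | lia | lia | rewrite -/z].
      apply: run_seq.
        apply: (@run_walk b (set_var s1 x_z z) T) => //=.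
        - by rewrite fv.
        - by rewrite fa.
        - by rewrite fa.
      move=> s2 /=; rewrite !fa // => walk2 fr2.
      have E2 : env s2.
        apply: env_frame fr2 _; first by case: (b).
        by case: E1; split.
      have [g0 g1 g2 g3 g4 g5 g6] := E2.
      have v2 x : x \in [:: x_t0; x_h0; x_k0; x_yes; x_no; x_i; x_s] ->
          var s2 x = var s1 x.
        rewrite !inE => mem; rewrite (proj1 fr2) /=.
          by repeat case/predU1P: mem => [-> //|mem]; rewrite (eqP mem).
        by case: (b); repeat case/predU1P: mem => [-> //|mem]; rewrite (eqP mem).
      have z2 : var s2 x_z = z by rewrite (proj1 fr2) //; case: (b).
      have a2 : arr s2 (a_class b) = arr s1 (a_class b) /\
                arr s2 (a_rest b) = arr s1 (a_rest b).
        by rewrite !(proj2 fr2) //; case: (b).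
      have lt_k := offs_next ok_k.
      have lt_w : walk (arr s a_par) (arr s a_col) (graph b) z h < n.
        exact: (@walk_stable _ offs _ _ _ _ T).
      have lt_g : var s2 (x_graph b) <= 2 + d * n by case: (b); rewrite /= ?g4 ?g5; lia.
      apply: run_get => /=; [by [] | by [] | rewrite (v2 x_t0) // (fv x_t0) // et; lia |].
      apply: run_get => /=; [by [] | by [] | rewrite (v2 x_h0) // (fv x_h0) // eh; lia |].
      rewrite (v2 x_t0) // (v2 x_h0) // (fv x_t0) // (fv x_h0) // et eh !walk2 //.
      apply: run_add => /=; first by rewrite (v2 x_k0) // (fv x_k0) // ek; lia.
      rewrite (v2 x_k0) // (fv x_k0) // ek.
      apply: run_add => /=; rewrite !x_graph_neq //; first by lia.
      apply: run_inp => /=; first by lia.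
      set r := inp _.
      have er : r = graph b k (walk (arr s a_par) (arr s a_col) (graph b) z h).
        by rewrite /r /graph; congr inp; case: (b); rewrite /= ?g4 ?g5; lia.
      have XiS : Xi (var s1 x_i).+1 = rcons (Xi (var s1 x_i)) z.
        by rewrite /Xi mkseqS -ez.
      have le_yes : var s1 x_yes <= var s1 x_i.
        by rewrite ey size_filter (leq_trans (count_size _ _)) // size_mkseq.
      have le_no : var s1 x_no <= var s1 x_i.
        by rewrite en size_filter (leq_trans (count_size _ _)) // size_mkseq.
      apply: run_bind; apply: run_if_neq => /= ne.
        have sat0 : sat true z = false by rewrite /sat /closes -er; apply/negP; lia.
        have sat1 : sat false z by move: sat0; rewrite /sat; case: closes.
        apply: run_put => /=; [by [] | lia | rewrite v2 //; lia | ].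
        apply: run_add => /=; first by rewrite v2 //; lia.
        apply: run_nil.
        apply: run_add => /=; first by rewrite v2 //; lia.
        apply: run_nil; rewrite /= !(v2 x_i) // !(v2 x_no) // !(v2 x_s) // z2 g3.
        split; last by lia.
        split=> /=; rewrite ?(v2 x_yes) //; first by lia.
          rewrite !addn1 XiS !filter_rcons sat0 sat1 (negPf nx) (proj1 a2).
          split=> //; first by rewrite size_rcons en.
          rewrite eqxx mkseqS (proj2 a2) /update eqxx; congr rcons.
          rewrite -eU; apply/eq_in_map => i; rewrite mem_iota => lt_i.
          by case: eqP => //; lia.
        by move=> i lt_i; rewrite (negPf nx) (proj1 a2) eqX //; lia.
      have sat1 : sat true z by rewrite /sat /closes -er; apply/eqP/eqP.
      have sat0 : sat false z = false by move: sat1; rewrite /sat; case: closes.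
      apply: run_put => /=; [by [] | lia | rewrite v2 //; lia | ].
      apply: run_add => /=; first by rewrite v2 //; lia.
      apply: run_nil.
      apply: run_add => /=; first by rewrite v2 //; lia.
      apply: run_nil; rewrite /= !(v2 x_i) // !(v2 x_yes) // !(v2 x_s) // z2 g3.
      split; last by lia.
      split=> /=; rewrite ?(v2 x_no) //; first by lia.
        rewrite !addn1 XiS !filter_rcons sat0 sat1 eq_sym (negPf nx) (proj2 a2).
        split=> //; first by rewrite size_rcons ey.
        rewrite eqxx mkseqS (proj1 a2) /update eqxx; congr rcons.
        rewrite -eX; apply/eq_in_map => i; rewrite mem_iota => lt_i.
        by case: eqP => //; lia.
      move=> i lt_i; rewrite eqxx /update (proj1 a2).
      by case: eqP => [|_]; [lia | rewrite eqX //; lia].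
    lia.
  move=> s1 [[le_i sp _] le_s1] fr; apply: run_nil.
  have es1 : var s1 x_s = sz by rewrite (proj1 fr) //; case: (b).
  have ei : var s1 x_i = sz by lia.
  by rewrite /X -/(Xi sz) -ei.
rewrite /= es; nia.
Qed.

Lemma run_copy b s m : env s -> var s x_no = m -> m <= n ->
  runs (copy_cmd b) s (10 * n)
    (fun s' => mkseq (arr s' (a_class b)) m = mkseq (arr s (a_rest b)) m).
Proof.
move=> E em le_m; have ledn := le_dn.
have nx : a_class b != a_rest b by case: (b).
have [na1 na2] : a_class b < 4 /\ a_rest b < 4 by case: (b).
rewrite /copy_cmd; eapply run_le.
  apply: run_cst; apply: run_seq.
    pose I s1 := var s1 x_i <= m /\
      forall i, i < var s1 x_i -> arr s1 (a_class b) i = arr s (a_rest b) i.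
    apply: (@run_for _ _ _ _ _ _ I _ _ _ _ 3) => //.
    move=> s1 [le_i eqX] fr lt.
    have E1 : env s1.
      apply: env_frame fr _; first by case: (b).
      by case: E; split.
    have em1 : var s1 x_no = m by rewrite (proj1 fr) //; case: (b).
    have ea : arr s1 (a_rest b) = arr s (a_rest b) by rewrite (proj2 fr) //; case: (b).
    have [f0 f1 f2 f3 f4 f5 f6] := E1; rewrite em1 in lt.
    apply: run_get => /=; [by [] | lia | lia | ].
    apply: run_put => /=; [by [] | lia | lia | ].
    apply: run_add => /=; first by lia.
    apply: run_nil; rewrite /= f3; split; last by lia.
    split=> /=; first by lia.
    move=> i lt_i; rewrite eqxx /update ea.
    by case: eqP => [-> //|ne]; apply: eqX; lia.
  move=> s1 [[le_i eqX] le_n] fr; apply: run_nil.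
  have em1 : var s1 x_no = m by rewrite (proj1 fr) //; case: (b).
  apply/eq_in_map => i; rewrite mem_iota => lt_i; apply: eqX; lia.
rewrite /= em; nia.
Qed.

Definition searching (x y : nat) (done : nat -> nat -> Prop) (s : state) : Prop :=
  search n offs (graph true) (graph false) x y (var s x_T) (arr s a_pos)
    (arr s a_q) (arr s a_img) (arr s a_par) (arr s a_col) done /\
  mismatch offs (graph true) (graph false) (var s x_bad) (var s x_h0)
    (var s x_k0) (var s x_t0) (var s x_T) (arr s a_pos) (arr s a_q) (arr s a_img) done.

Definition before (h k h' k' : nat) : Prop :=
  offs k' /\ (h' < h \/ h' = h /\ k' < k).

(** Offsets are multiples of n, so none lies strictly between [k] and [k + n]. *)
Lemma before_next h k h' k' : n %| k -> before h (k + n) h' k' ->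
  before h k h' k' \/ (h' = h /\ k' = k).
Proof.
move=> /dvdnP[q ->] [ok [lt_h|[-> lt_k]]]; first by left; split; last left.
case/andP: (ok) => _ /dvdnP[q' eq']; rewrite eq' in ok lt_k *.
have le_q : q' <= q.
  by move: lt_k; rewrite -mulSnr ltn_mul2r => /andP[_]; rewrite ltnS.
move: le_q; rewrite leq_eqVlt => /predU1P[->|lt_q]; [by right | left].
by split=> //; right; split=> //; rewrite ltn_mul2r; lia.
Qed.

Lemma run_visit x y s h k :
  env s -> searching x y (before h k) s ->
  var s x_h = h -> var s x_k = k -> h < var s x_T -> offs k ->
  var s x_q = arr s a_q h -> var s x_p = arr s a_img h ->
  runs visit_cmd s 20 (fun s' =>
    [/\ searching x y (before h (k + n)) s', var s' x_k = k + n,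
        h < var s' x_T, var s' x_q = arr s' a_q h & var s' x_p = arr s' a_img h]).
Proof.
move=> E [S M] eh ek lt_h ok_k eq ep; have ledn := le_dn.
have [e0 e1 e2 e3 e4 e5 e6] := E.
have le_T := search_le S.
have [lt_q lt_i _] := search_list S lt_h; rewrite -eq in lt_q; rewrite -ep in lt_i.
have lt_k := offs_next ok_k; have nk : n %| k by case/andP: ok_k.
pose u := graph true k (var s x_q); pose r := graph false k (var s x_p).
have lt_u : u < n by apply: st.
have lt_r : r < n by apply: st.
rewrite /visit_cmd; eapply run_le.
  apply: run_add => /=; first by lia.
  apply: run_add => /=; first by lia.
  apply: run_inp => /=; first by lia.
  rewrite e4 ek -/(graph true k (var s x_q)) -/u.
  apply: run_add => /=; first by lia.
  apply: run_add => /=; first by lia.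
  apply: run_inp => /=; first by lia.
  rewrite e5 ek -/(graph false k (var s x_p)) -/r.
  apply: run_get => /=; [by [] | by [] | by [] | ].
  apply: run_bind; apply: run_if => /= hu.
    have lt_pu : arr s a_pos u < n by rewrite -e1.
    have lt_p : arr s a_pos u < var s x_T.
      by have [] := search_pos S lt_u lt_pu.
    have S' : search n offs (graph true) (graph false) x y (var s x_T) (arr s a_pos)
        (arr s a_q) (arr s a_img) (arr s a_par) (arr s a_col) (before h (k + n)).
      apply: (search_seen S lt_h ok_k); last by rewrite -eq.
      by move=> h' k'; apply: before_next.
    eapply run_le.
      apply: run_get => /=; [by [] | by [] | by lia | ].
      apply: run_bind; apply: run_if_neq => /= ne.
        apply: run_cst.
        apply: run_add => /=; first by lia.
        apply: run_add => /=; first by lia.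
        apply: run_add => /=; first by lia.
        do 2!apply: run_nil; apply: run_add => /=; first by lia.
        apply: run_nil; rewrite /searching /= eh ek e1 e2 !addn0; split=> //; split=> //.
        rewrite /u eq; apply: (mismatch_found (st true) _ S lt_h ok_k); rewrite -eq //.
        by rewrite -ep.
      eapply run_le.
        exists 0; eexists; split; [exact: ev_skip | by [] |].
        apply: run_nil; apply: run_add => /=; first by lia.
        apply: run_nil; rewrite /searching /= ek e1; split=> //; split=> //.
        apply: (mismatch_seen (h := h) (k := k) _ M); last by rewrite -eq -ep.
        by move=> h' k'; apply: before_next.
      by [].
    by [].
  have le_pu : n <= arr s a_pos u by rewrite -e1.
  have lt_T : var s x_T < n := search_lt S lt_u le_pu.
  eapply run_le.
    do 5![apply: run_put => /=; [by [] | by [] | lia |]].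
    apply: run_add => /=; first by lia.
    apply: run_nil; apply: run_add => /=; first by lia.
    apply: run_nil; rewrite /searching /= eh ek e1 e3 !addn1 /update.
    have neT : (h == var s x_T) = false by lia.
    rewrite neT; split=> //; last by lia.
    split; rewrite /u /r eq ep.
      apply: (search_new (st true) (st false) S lt_h ok_k); last by rewrite -eq.
      by move=> h' k'; apply: before_next.
    apply: (mismatch_new (st true) S lt_h ok_k _ M); last by rewrite -eq.
    by move=> h' k'; apply: before_next.
  by [].
by [].
Qed.

Lemma run_row x y s h :
  env s -> searching x y (before h 0) s ->
  var s x_h = h -> var s x_k = 0 -> h < var s x_T ->
  var s x_q = arr s a_q h -> var s x_p = arr s a_img h ->
  runs (While x_k x_dn visit_cmd) s (21 * d).+1 (fun s' =>
    searching x y (before h.+1 0) s' /\ h < var s' x_T).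
Proof.
move=> E SM eh ek lt_h eq ep; have ledn := le_dn.
pose I s1 := [/\ searching x y (before h (var s1 x_k)) s1,
  n %| var s1 x_k /\ var s1 x_k <= d * n,
  h < var s1 x_T, var s1 x_q = arr s1 a_q h & var s1 x_p = arr s1 a_img h].
(* The counter advances by n, so its quotient by n counts the visits; each costs 20 steps and one
   test. *)
pose f s1 := (d - var s1 x_k %/ n) * 21.
have n_gt0 : 0 < n by lia.
eapply run_weaken.
- apply: run_frame; apply: (@run_while _ _ _ _ _ _ I f).
    by split; rewrite // ek ?dvdn0.
  move=> s1 [SM1 [nk le_k] lt_h1 eq1 ep1] fr lt; exists 20.
  have E1 : env s1 by apply: env_frame fr E.
  have ok_k : offs (var s1 x_k) by rewrite /offs nk -(env_dn E1) lt.
  have eh1 : var s1 x_h = h by rewrite (proj1 fr).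
  apply: run_weaken (run_visit E1 SM1 eh1 erefl lt_h1 ok_k eq1 ep1) _ _ => //.
  move=> s2 [SM2 ek2 lt_h2 eq2 ep2]; split.
    split; rewrite ?ek2 //; split; last exact: offs_next.
    by rewrite dvdn_add.
  rewrite /f ek2 divnDr // divnn n_gt0 addn1.
  have : var s1 x_k %/ n < d by rewrite ltn_divLR // -(env_dn E1).
  nia.
- by rewrite /f ek div0n; lia.
move=> s1 [[[[S M] [nk le_k] lt_h1 _ _] ge_k] fr]; split=> //.
rewrite (proj1 fr) // (env_dn E) in ge_k.
have sub h' k' : before h.+1 0 h' k' -> before h (var s1 x_k) h' k'.
  move=> [ok [le_h|[_ //]]]; split=> //; have := offs_lt ok; lia.
by split; [apply: search_weaken S sub | apply: mismatch_weaken M sub].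
Qed.

Lemma run_search x y s :
  env s -> var s x_z = x -> var s x_q = y -> x < n -> y < n ->
  runs search_cmd s (100 * (d * n)) (fun s' =>
    searching x y (fun h k => h < var s' x_T /\ offs k) s').
Proof.
move=> E ex ey lt_x lt_y; have ledn := le_dn.
have [e0 e1 e2 e3 e4 e5 e6] := E.
rewrite /search_cmd; eapply run_le.
  apply: run_cst; apply: run_seq.
    pose I s1 := var s1 x_i <= n /\
      forall i, i < var s1 x_i -> arr s1 a_pos i = n.
    apply: (@run_for _ _ _ _ _ _ I _ _ _ _ 2) => //.
    move=> s1 [le_i eqn] fr lt.
    have E1 : env s1 by apply: env_frame fr _ => //; case: E; split.
    have [f0 f1 f2 f3 f4 f5 f6] := E1; rewrite f1 in lt.
    apply: run_put => /=; [by [] | by [] | lia | ].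
    apply: run_add => /=; first by lia.
    apply: run_nil; rewrite /= f1 f3; split; last by lia.
    split=> /=; first by lia.
    by move=> i lt_i; rewrite /update; case: eqP => // ne; apply: eqn; lia.
  move=> s1 [[_ eqn] le_n] fr.
  have E1 : env s1 by apply: env_frame fr _ => //; case: E; split.
  have [f0 f1 f2 f3 f4 f5 f6] := E1; rewrite f1 in le_n.
  have ex1 : var s1 x_z = x by rewrite (proj1 fr).
  have ey1 : var s1 x_q = y by rewrite (proj1 fr).
  apply: run_put => /=; [by [] | by [] | lia | ].
  apply: run_put => /=; [by [] | by [] | lia | ].
  apply: run_put => /=; [by [] | by [] | lia | ].
  do 3!apply: run_cst; rewrite ex1 ey1 f2.
  set s2 := set_var _ _ _.
  have E2 : env s2 by case: E1; split.
  have SM2 : searching x y (before 0 0) s2.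
    split.
      apply: (search_weaken (done := fun _ _ => False)).
        by apply: search_start => // v lt_v; apply: eqn; lia.
      by move=> h k [_]; lia.
    apply: (mismatch_weaken (done := fun _ _ => False)); first exact: mismatch_start.
    by move=> h k [_]; lia.
  apply: (@run_seq _ _ _ _ _ _ _ _ _ (n * (30 * d)).+1).
    pose I s3 := searching x y (before (var s3 x_h) 0) s3 /\ var s3 x_h <= var s3 x_T.
    (* The limit [x_T] of this loop grows while it runs, so the potential counts towards n, which
       bounds [x_T] by [search_le]. Each node takes at most [28 * d] steps. *)
    pose f s3 := (n - var s3 x_h) * (30 * d).
    apply: (@run_le _ _ _ _ _ _ _ _ (f s2).+1); last by rewrite /f /s2 /= subn0.
    apply: (@run_while _ _ _ _ _ _ I f); first by split.
    move=> s3 [SM3 _] fr3 lt; exists (28 * d).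
    have E3 : env s3 by apply: env_frame fr3 _.
    have le_T := search_le SM3.1.
    have [g0 g1 g2 g3 g4 g5 g6] := E3.
    eapply run_le.
      apply: run_get => /=; [by [] | by [] | lia | ].
      apply: run_get => /=; [by [] | by [] | lia | ].
      apply: run_cst; apply: run_seq.
        by apply: (@run_row x y _ (var s3 x_h)) => //; case: E3; split.
      move=> s4 [SM4 lt4] fr4.
      have E4 : env s4 by apply: env_frame fr4 _ => //; case: E3; split.
      have eh4 : var s4 x_h = var s3 x_h by rewrite (proj1 fr4).
      apply: run_add => /=; first by rewrite eh4 (env_1 E4); lia.
      apply: run_nil; rewrite /I /f /= eh4 (env_1 E4) addn1; split=> //.
      by have := lt; nia.
    lia.
  move=> s3 [[[S M] _] le_h] fr3; apply: run_nil; split.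
    by apply: (search_weaken S) => h k [lt_h ok]; split=> //; left; lia.
  by apply: (mismatch_weaken M) => h k [lt_h ok]; split=> //; left; lia.
rewrite /= e1; nia.
Qed.

(** * Rounds of refinement and the total running time *)

Definition class (s : state) (b : bool) : seq nat :=
  mkseq (arr s (a_class b)) (var s x_s).

Local Notation iso := (graph_iso n offs (graph true) (graph false)).

Record refining (s : state) : Prop := Refining {
  refining_env : env s;
  refining_size : 0 < var s x_s <= n;
  refining_lt : forall b, all (gtn n) (class s b);
  refining_iso : forall f, iso f -> perm_eq (map f (class s true)) (class s false) }.

Definition decided (s : state) : Prop :=
  var s x_go = 0 /\ var s x_ans = 1 /\ (exists f, iso f) \/
  var s x_go = 0 /\ var s x_ans = 0 /\ ~ (exists f, iso f).

Lemma class_lt s b i : all (gtn n) (class s b) -> i < var s x_s ->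
  arr s (a_class b) i < n.
Proof. by move/allP=> lt_c lt_i; apply: lt_c; apply: map_f; rewrite mem_iota. Qed.

Lemma size_split (T : Type) (p : pred T) (l : seq T) :
  size (filter (fun z => p z == true) l) + size (filter (fun z => p z == false) l)
  = size l.
Proof.
rewrite !size_filter -(count_predC (fun z => p z == true)); congr (_ + _).
by apply: eq_count => z /=; case: (p z).
Qed.

(** The search contributes O(dn), and following the walks from every vertex of the two classes O(n)
    per vertex. The copying is O(n), absorbed because the classes are not empty. *)
Lemma run_round s : refining s -> var s x_go = 1 -> var s x_ans = 1 ->
  runs round_cmd s (200 * (d * n + n * var s x_s)) (fun s' =>
    decided s' \/ [/\ refining s', var s' x_go = 1, var s' x_ans = 1 &
                      (var s' x_s).*2 <= var s x_s]).
Proof.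
move=> R ego eans; have ledn := le_dn.
have [E /andP[s_gt0 le_s] ltX isoX] := R; set sz := var s x_s in s_gt0 le_s *.
have [e0 e1 e2 e3 e4 e5 e6] := E.
pose x := arr s (a_class true) 0; pose y := arr s (a_class false) 0.
have lt_x : x < n by apply: (@class_lt s true).
have lt_y : y < n by apply: (@class_lt s false).
rewrite /round_cmd; eapply run_le.
  apply: run_get => /=; [by [] | by [] | lia | rewrite e2 -/x].
  apply: run_get => /=; [by [] | by [] | lia | rewrite e2 -/y].
  apply: run_seq; first by apply: (@run_search x y) => //; case: E; split.
  move=> s1 [S M] fr1.
  have E1 : env s1 by apply: env_frame fr1 _ => //; case: E; split.
  have v1 v : v \in [:: x_s; x_go; x_ans] -> var s1 v = var s v.
    by rewrite !inE => mem; rewrite (proj1 fr1);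
      repeat case/predU1P: mem => [-> //|mem]; rewrite (eqP mem).
  have a1 b : arr s1 (a_class b) = arr s (a_class b).
    by rewrite (proj2 fr1); case: b.
  apply: (@run_bind _ _ _ _ _ _ _ _ _ (150 * (n * sz)).+1).
  apply: run_if => hbad; last first.
    exists 1; eexists; split; [exact: ev_cst | nia |].
    apply: run_nil; left; left; rewrite /= v1 //; split=> //; split=> //.
    have bad0 : var s1 x_bad = 0 by have := env_0 E1; lia.
    rewrite bad0 in M.
    by apply: (search_success (st true) (@con true) (@con false) S M).
  rewrite (env_0 E1) in hbad.
  have [lt_h lt_t ok_k clx cly] := search_separates S M hbad.
  have le_T := search_le S; have T_gt0 := search_gt0 S.
  have tr : tree (arr s1 a_par) (var s1 x_T) by move=> i /(search_tree S)[].
  have ok_col i : 0 < i < var s1 x_T -> offs (arr s1 a_col i).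
    by move/(search_tree S)=> [].
  pose sat b c z := closes (arr s1 a_par) (arr s1 a_col) (graph b) (var s1 x_h0)
    (var s1 x_k0) (var s1 x_t0) z == c.
  have splitI f c : iso f -> perm_eq (map f (filter (sat true c) (class s true)))
                             (filter (sat false c) (class s false)).
    by move=> If; apply: (split_iso (st true) If tr ok_col) => //; apply: isoX.
  have es1 : var s1 x_s = sz by rewrite v1.
  eapply run_le.
  apply: run_seq.
    have bT : 0 < var s1 x_T <= n by rewrite T_gt0.
    have lt1 i : i < sz -> arr s1 (a_class true) i < n.
      by move=> lt_i; rewrite a1; apply: class_lt.
    exact: (@run_split true s1 sz _ _ _ _ E1 es1 le_s erefl bT erefl erefl erefl
      lt_h lt_t ok_k tr ok_col lt1).
  move=> s2 /= [yes2 no2 X2 U2] fr2.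
  have a2 j : j \in [:: 2; a_par; a_col] -> arr s2 j = arr s1 j.
    by rewrite !inE => mem; rewrite (proj2 fr2);
      repeat case/predU1P: mem => [-> //|mem]; rewrite (eqP mem).
  have v2 v : v \in [:: x_s; x_T; x_h0; x_k0; x_t0; x_go; x_ans] ->
      var s2 v = var s1 v.
    by rewrite !inE => mem; rewrite (proj1 fr2);
      repeat case/predU1P: mem => [-> //|mem]; rewrite (eqP mem).
  have E2 : env s2 by apply: env_frame fr2 _.
  have eX : mkseq (arr s1 0) sz = class s true by rewrite (a1 true).
  rewrite eX in yes2 no2 X2 U2.
  rewrite -/(sat true true) -/(sat true false) in yes2 no2 X2 U2.
  pose L b c := filter (sat b c) (class s b).
  have szL b : size (L b true) + size (L b false) = sz.
    by rewrite size_split size_mkseq.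
  rewrite -/(L true true) -/(L true false) in yes2 no2 X2 U2.
  have szT := szL true; have szF := szL false.
  apply: run_add => /=; first by rewrite (env_0 E2); lia.
  rewrite (env_0 E2) addn0 yes2.
  set s2' := set_var _ _ _.
  have E2' : env s2' by case: E2; split.
  apply: run_seq.
    have lt1 i : i < sz -> arr s2' (a_class false) i < n.
      by move=> lt_i; rewrite /= a2 // (a1 false); apply: (@class_lt s false).
    have p2 : arr s2' a_par = arr s1 a_par by rewrite /= a2.
    have c2 : arr s2' a_col = arr s1 a_col by rewrite /= a2.
    have bT : 0 < var s2' x_T <= n by rewrite /= v2 // T_gt0.
    apply: (@run_split false s2' sz (var s1 x_T) (var s1 x_h0) (var s1 x_k0)
      (var s1 x_t0)) => //; rewrite ?p2 ?c2 //=; try by rewrite v2.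
    by rewrite T_gt0.
  have as2 : arr s2' = arr s2 by [].
  move=> s3; rewrite !as2 [a_class false]/= (a2 a_par) // (a2 a_col) // (a2 2) //.
  rewrite (a1 false).
  move=> [yes3 no3 X3 U3] fr3.
  rewrite -/(class s false) in yes3 no3 X3 U3.
  rewrite -/(sat false true) -/(sat false false) in yes3 no3 X3 U3.
  rewrite -/(L false true) -/(L false false) in yes3 no3 X3 U3.
  have E3 : env s3 by apply: env_frame fr3 _.
  have c3 : var s3 x_saved = size (L true true) by rewrite (proj1 fr3).
  have v3 v : v \in [:: x_s; x_go; x_ans] -> var s3 v = var s v.
    by rewrite !inE => mem; rewrite (proj1 fr3) ?/s2' /= ?v2 ?v1 //;
      repeat case/predU1P: mem => [-> //|mem]; rewrite (eqP mem).
  have X3' : mkseq (arr s3 0) (size (L true true)) = L true true.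
    by rewrite (proj2 fr3) // /s2' /= -yes2.
  have U3' : mkseq (arr s3 1) (size (L true false)) = L true false.
    by rewrite (proj2 fr3) // /s2' /= -no2.
  (* [x] and [y] lie in parts that do not correspond: [x] makes the first part nonempty, [y] the
     second, and equal sizes carry this over to the other graph. *)
  have x_in : x \in L true true.
    by rewrite mem_filter /sat clx; apply/mapP; exists 0; rewrite ?mem_iota.
  have y_in : y \in L false false.
    by rewrite mem_filter /sat (negPf cly); apply/mapP; exists 0; rewrite ?mem_iota.
  have pos_x : 0 < size (L true true) by case: (L true true) x_in.
  have pos_y : 0 < size (L false false) by case: (L false false) y_in.
  (* The common end of the two successful branches; [c] tells which part is kept. *)
  have fin c s4 : env s4 -> var s4 x_go = 1 -> var s4 x_ans = 1 ->
      var s4 x_s = size (L true c) -> (forall b, class s4 b = L b c) ->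
      0 < size (L true c) -> (size (L true c)).*2 <= sz ->
      decided s4 \/ [/\ refining s4, var s4 x_go = 1, var s4 x_ans = 1 &
                       (var s4 x_s).*2 <= sz].
    move=> E4 go4 ans4 es4 eq4 pos4 half4; right; split; rewrite ?es4 //.
    split; rewrite ?es4 //.
    - by rewrite pos4; lia.
    - move=> b; rewrite eq4 all_filter.
      by apply: sub_all (ltX b) => v lt_v /=; apply/implyP.
    by move=> f If; rewrite !eq4; apply: splitI.
  apply: (@run_bind _ _ _ _ _ _ _ _ _ (20 * n + 7).+3).
  apply: run_if_neq => hc.
    eapply run_le.
      do 2!apply: run_cst; do 3!apply: run_nil; left; right; split=> //; split=> //.
      (* An isomorphism would map the vertices with the property in one class bijectively to those
         in the other. *)
      move=> [f If]; apply: hc; rewrite c3 yes3.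
      by have /perm_size := splitI f true If; rewrite size_map.
    by lia.
  have eqT : size (L true true) = size (L false true) by rewrite -c3 -yes3.
  have eqF : size (L true false) = size (L false false) by lia.
  apply: run_if => hlt.
    eapply run_le.
      apply: run_seq.
        by apply: (run_copy true E3 no3); lia.
      rewrite -eqF [a_class true]/= [a_rest true]/= U3' => s4 C4 fr4.
      have E4 : env s4 by apply: env_frame fr4 _.
      apply: run_seq.
        apply: (run_copy false E4 (m := size (L false false))); last by lia.
        by rewrite (proj1 fr4).
      rewrite (proj2 fr4) // -no3 U3 => s5 C5 fr5.
      have E5 : env s5 by apply: env_frame fr5 _.
      have no5 : var s5 x_no = size (L true false).
        by rewrite (proj1 fr5) // (proj1 fr4) // eqF.
      apply: run_add => /=; first by rewrite no5 (env_0 E5); lia.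
      do 3!apply: run_nil; apply: (fin false) => /=.
      - by case: E5; split.
      - by rewrite (proj1 fr5) // (proj1 fr4) // v3.
      - by rewrite (proj1 fr5) // (proj1 fr4) // v3.
      - by rewrite no5 (env_0 E5) addn0.
      - rewrite /class /= no5 (env_0 E5) addn0; case.
          by rewrite (proj2 fr5).
        by rewrite eqF -no3.
      - by rewrite eqF.
      by move: hlt; rewrite yes3 no3; lia.
    by lia.
  eapply run_le.
    apply: run_add => /=; first by rewrite yes3 (env_0 E3); lia.
    do 3!apply: run_nil; apply: (fin true) => /=.
    - by case: E3; split.
    - by rewrite v3.
    - by rewrite v3.
    - by rewrite yes3 (env_0 E3) addn0.
    - rewrite /class /= yes3 (env_0 E3) addn0; case; last by rewrite -yes3.
      by rewrite -eqT.
    - by [].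
    by move: hlt; rewrite yes3 no3; lia.
  by lia.
  nia.
nia.
Qed.

Lemma iso_perm f : iso f -> perm_eq (map f (iota 0 n)) (iota 0 n).
Proof.
case=> lt_f inj_f _.
have uniq_f : uniq (map f (iota 0 n)).
  rewrite map_inj_in_uniq ?iota_uniq // => v v'.
  by rewrite !mem_iota; apply: inj_f.
apply: uniq_perm; rewrite ?iota_uniq //.
apply: (uniq_min_size uniq_f _ _).2; last by rewrite size_map.
by move=> u /mapP[v]; rewrite !mem_iota => lt_v ->; apply: lt_f.
Qed.

Lemma run_rounds s : refining s -> var s x_go = 1 -> var s x_ans = 1 ->
  var s x_s = n ->
  runs (While x_0 x_go round_cmd) s
    (201 * (d * n * (trunc_log 2 n).+1 + 2 * (n * n))).+1 decided.
Proof.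
move=> R ego eans es.
pose I s1 := decided s1 \/ [/\ refining s1, var s1 x_go = 1 & var s1 x_ans = 1].
(* Halving the size s lowers the logarithm by 1, which pays for the search, and [2 * (n * s)] by at
   least [n * s], which pays for the splitting. The excess of 201 over 200 covers the test of the
   loop, and the factor [x_go] makes the potential vanish once the answer is known. *)
pose f s1 := var s1 x_go *
  (201 * (d * n * (trunc_log 2 (var s1 x_s)).+1 + 2 * (n * var s1 x_s))).
eapply run_weaken.
- apply: (@run_while _ _ _ _ _ _ I f); first by right.
  move=> s1 Is1 _ lt.
  case: Is1 => [[[go0 _]|[go0 _]]|[R1 go1 ans1]]; [lia | lia |].
  exists (200 * (d * n + n * var s1 x_s)).
  apply: run_weaken (run_round R1 go1 ans1) _ _ => // s2.
  case=> [D|[R2 go2 ans2 half]].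
    split; first by left.
    rewrite /f go1; case: D => -[-> _]; rewrite mul0n mul1n; nia.
  split; first by right.
  have [_ /andP[s2_gt0 _] _ _] := R2.
  have := trunc_log_half s2_gt0 half.
  rewrite /f go1 go2 !mul1n -mul2n in half *.
  set l2 := trunc_log 2 _; set l1 := trunc_log 2 _ => le_l.
  have le1 : d * n * l2.+1 <= d * n * l1 by rewrite leq_mul2l le_l orbT.
  have le2 : n * (2 * var s2 x_s) <= n * var s1 x_s by rewrite leq_mul2l half orbT.
  by rewrite mulnS; have := ltnW n_gt1; have := le_dn; lia.
- by rewrite /f ego es mul1n.
move=> s1 [[//|[R1 go1 _]] le_go].
by rewrite go1 (env_0 (refining_env R1)) in le_go.
Qed.

Hypotheses (inp_n : inp 0 = n) (inp_d : inp 1 = d).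

Lemma run_main :
  runs main_cmd (State (fun=> 0) (fun _ _ => 0))
    (1000 * (n ^ 2 + d * n * trunc_log 2 n)) decided.
Proof.
have ledn := le_dn.
(* As the logarithm is at least 1 for n > 1, the cost of the preparations and the additional 1 in
   the number of searches are absorbed. *)
have log_gt0 : 0 < trunc_log 2 n by rewrite trunc_log_gt0.
rewrite /main_cmd; eapply run_le.
  do 2!apply: run_cst.
  apply: run_inp => //=; apply: run_inp => //=.
  rewrite inp_n inp_d; apply: run_cst.
  apply: (@run_bind _ _ _ _ _ _ _ _ _ (20 * (d * n) +
     (201 * (d * n * (trunc_log 2 n).+1 + 2 * (n * n))).+1).+1).
  apply: run_if => /=; last by lia.
  move=> _; eapply run_le.
    apply: run_add => /=; first by lia.
    do 2!apply: run_cst.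
    apply: run_seq.
      pose I s1 := var s1 x_i <= d /\ var s1 x_dn = var s1 x_i * n.
      apply: (@run_for _ _ _ _ _ _ I _ _ _ _ 2) => //.
      move=> s1 [le_i edn] fr lt.
      have n1 : var s1 x_n = n by rewrite (proj1 fr).
      have d1 : var s1 x_d = d by rewrite (proj1 fr).
      have o1 : var s1 x_1 = 1 by rewrite (proj1 fr).
      rewrite d1 in lt; have : var s1 x_i * n <= d * n by rewrite leq_mul2r le_i orbT.
      move=> le_in; apply: run_add => /=; first by lia.
      apply: run_add => /=; first by nia.
      apply: run_nil; rewrite /= o1 d1; split; last by lia.
      by split=> /=; [lia | rewrite edn n1 addn1 mulSn addnC].
    move=> s1 [[le_i edn] ge_i] fr.
    have n1 : var s1 x_n = n by rewrite (proj1 fr).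
    have d1 : var s1 x_d = d by rewrite (proj1 fr).
    have o1 : var s1 x_1 = 1 by rewrite (proj1 fr).
    have z1 : var s1 x_0 = 0 by rewrite (proj1 fr).
    have A1 : var s1 x_A = 2 by rewrite (proj1 fr).
    have ans1 : var s1 x_ans = 1 by rewrite (proj1 fr).
    have {}edn : var s1 x_dn = d * n by rewrite edn; congr (_ * _); lia.
    apply: run_add => /=; first by lia.
    apply: run_add => /=; first by lia.
    apply: run_cst; rewrite A1 edn.
    set s2 := set_var _ _ _.
    have E2 : env s2 by split.
    have ans2 : var s2 x_ans = 1 by [].
    apply: (@run_seq _ _ _ _ _ _ _ _ _ (n * 4).+1).
      pose I s3 := var s3 x_i <= n /\
        forall b i, i < var s3 x_i -> arr s3 (a_class b) i = i.
      apply: (@run_le _ _ _ _ _ _ _ _ ((var s2 x_n - var s2 x_i) * 4).+1).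
        apply: (@run_for _ _ _ _ _ _ I _ _ _ _ 3) => //.
        move=> s3 [le3 eq3] fr3 lt.
        have E3 : env s3 by apply: env_frame fr3 _.
        have [f0 f1 f2 f3 f4 f5 f6] := E3; rewrite f1 in lt.
        apply: run_put => /=; [by [] | by [] | lia |].
        apply: run_put => /=; [by [] | by [] | lia |].
        apply: run_add => /=; first by lia.
        apply: run_nil; rewrite /= f1 f3; split; last by lia.
        split=> /=; first by lia.
        by case=> i lt_i; rewrite /= /update; case: eqP => // ne;
          [apply: (eq3 true) | apply: (eq3 false)]; lia.
      by rewrite /= n1 subn0.
    move=> s3 [[le3 eq3] ge3] fr3.
    have E3 : env s3 by apply: env_frame fr3 _.
    have [f0 f1 f2 f3 f4 f5 f6] := E3; rewrite f1 in ge3.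
    have ei : var s3 x_i = n by lia.
    apply: run_add => /=; first by lia.
    apply: run_cst; rewrite f1 f2 addn0.
    apply: run_seq.
      apply: run_rounds => //=; last by rewrite (proj1 fr3).
      have clE b : class (set_var (set_var s3 x_s n) x_go true) b = iota 0 n.
        rewrite -[RHS]map_id /class /=; apply/eq_in_map => i; rewrite mem_iota.
        by move=> lt_i; apply: eq3; lia.
      split; first by case: E3; split.
      - by rewrite /= leqnn; lia.
      - by move=> b; rewrite clE; apply/allP => i; rewrite mem_iota.
      by move=> f If; rewrite !clE; apply: iso_perm.
    by move=> s4 D _; do 2!apply: run_nil.
  by rewrite /=; nia.
rewrite /= mulnS -mulnn.
have : d * n <= d * n * trunc_log 2 n by rewrite leq_pmulr.
set l := d * n * _; nia.
Qed.

End Correctness.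

(** For n = 1 the guard skips every array access, so [base], [len] and [n_arr] are arbitrary
    here. *)
Lemma run_main1 bound n_inp inp base len n_arr :
  2 < bound -> 1 < n_inp -> inp 0 = 1 ->
  runs bound n_inp inp base len n_arr main_cmd (State (fun=> 0) (fun _ _ => 0))
    10 (fun s => var s x_ans = 1).
Proof.
move=> b_gt2 n_gt1 inp1; rewrite /main_cmd; eapply run_le.
  do 2!apply: run_cst.
  apply: run_inp => /=; first by lia.
  apply: run_inp => //=; rewrite inp1; apply: run_cst.
  apply: (@run_bind _ _ _ _ _ _ _ _ _ 1).
  apply: run_if => //= _; exists 0; eexists; split; [exact: ev_skip | by [] |].
  exact: run_nil.
by [].
Qed.

(** * The machine program *)

Lemma digits_words w x j q :
  digits w (fun i => (x %/ 2 ^ (w * i)) %% 2 ^ w) j q =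
  (x %/ 2 ^ (w * j)) %% 2 ^ (w * q).
Proof.
elim: q j => [|q IH] j; first by rewrite muln0 modn1.
rewrite digitsS IH !mulnSr !expnD divnMA; set y := x %/ _.
rewrite [RHS](divn_eq _ (2 ^ w)) modn_divl addnC mulnC; congr (_ + _).
by rewrite modn_dvdm // dvdn_mull.
Qed.

Lemma nth_flatten_words w m s i j : j < m -> i < size s ->
  nth 0 (flatten [seq words w m x | x <- s]) (m * i + j) =
  nth 0 (words w m (nth 0 s i)) j.
Proof.
move=> lt_j; elim: s i => [|x s IH] [|i] //= lt_i; rewrite nth_cat size_mkseq.
  by rewrite muln0 add0n lt_j.
by rewrite ifF ?mulnS; [rewrite -addnA addKn IH | lia].
Qed.

Lemma size_flatten_words w m s :
  size (flatten [seq words w m x | x <- s]) = m * size s.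
Proof.
by elim: s => [|x s IH] /=; rewrite ?muln0 // size_cat size_mkseq IH mulnS.
Qed.

Lemma nth_allpairs (S T R : Type) (f : S -> T -> R) s t x0 y0 z0 i j :
  i < size s -> j < size t ->
  nth z0 [seq f x y | x <- s, y <- t] (i * size t + j) =
  f (nth x0 s i) (nth y0 t j).
Proof.
move=> lt_i lt_j; elim: s i lt_i => [|x s IH] [|i] //= lt_i.
  by rewrite nth_cat size_map lt_j (nth_map y0).
by rewrite nth_cat size_map ifF ?mulSn; [rewrite -addnA addKn IH | lia].
Qed.

(** * From permutation digraphs to graphs on numbers *)

Section Tables.

Variables (n d : nat).
Implicit Type a : d.-tuple {perm 'I_n}.

Lemma size_table a : size (table a) = d * n.
Proof. by rewrite /table size_allpairs !size_enum_ord. Qed.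

Lemma nth_table a (k : 'I_d) (i : 'I_n) : nth 0 (table a) (k * n + i) = tnth a k i.
Proof.
have := @nth_allpairs _ _ _ (fun k i => val (tnth a k i)) (enum 'I_d) (enum 'I_n)
  k i 0 k i.
by rewrite !size_enum_ord !nth_ord_enum => ->.
Qed.

Variables a a' : d.-tuple {perm 'I_n}.

Definition numbers : seq nat := [:: n, d & table a ++ table a'].

Local Notation gr := (graph n d (nth 0 numbers)).

Lemma graph_table b (k : 'I_d) (i : 'I_n) :
  gr b (k * n) i = tnth (if b then a else a') k i.
Proof.
have lt_ki : k * n + i < d * n.
  have := ltn_ord k; have := ltn_ord i; nia.
rewrite /graph -addnA; case: b => /=.
  by rewrite nth_cat size_table lt_ki nth_table.
rewrite -addnA /= nth_cat !size_table ifF; last by lia.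
by rewrite add0n addKn nth_table.
Qed.

Lemma offsP k : offs n d k -> exists q : 'I_d, k = q * n.
Proof.
case/andP=> lt_k /dvdnP[q eq_k].
have lt_q : q < d by move: lt_k; rewrite eq_k ltn_mul2r => /andP[].
by exists (Ordinal lt_q).
Qed.

Lemma offs_ord (k : 'I_d) (i : 'I_n) : offs n d (k * n).
Proof. by rewrite /offs dvdn_mull // ltn_mul2r ltn_ord (leq_ltn_trans _ (ltn_ord i)). Qed.

Lemma graph_stable b : stable n (offs n d) (gr b).
Proof.
by move=> k v /offsP[q ->] lt_v; rewrite (graph_table b q (Ordinal lt_v)).
Qed.

Lemma graph_connected b :
  strongly_connected (perm_digraph (if b then a else a')) ->
  connected n (offs n d) (gr b).
Proof.
move=> con U [v lt_v Uv] closed u lt_u.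
have /connectP[p path_p eq_u] := con (Ordinal lt_v) (Ordinal lt_u).
have -> : u = val (last (Ordinal lt_v : vertex (perm_digraph (if b then a else a'))) p).
  by rewrite -eq_u.
elim: p (Ordinal lt_v) (Uv : U (val (Ordinal lt_v))) path_p {eq_u} => //= y p IH x Ux.
case/andP=> /existsP[[i k] /= /andP[/eqP eq_i /eqP <-]]; rewrite -eq_i in Ux *.
apply: IH; rewrite -graph_table; apply: closed => //; first exact: (offs_ord k i).
Qed.

(** An arc is determined by its initial vertex and its color, so the map on vertices forces the map
    on arcs, and preservation of terminal vertices becomes the homomorphism equation. *)
Lemma color_isomorphicP :
  (exists f, graph_iso n (offs n d) (gr true) (gr false) f) <->
  color_isomorphic (perm_digraph a) (perm_digraph a').
Proof.
split=> [[f [lt_f inj_f hom_f]]|[f [g [bij_f _ ini_g ter_g col_g]]]].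
  pose F (i : 'I_n) : 'I_n := Ordinal (lt_f i (ltn_ord i)).
  have inj_F : injective F by move=> i j [] /inj_f e; apply: val_inj; apply: e.
  exists F, (fun e => (F e.1, e.2)); split=> //.
  - exact: injF_bij.
  - by apply: injF_bij => -[i k] [j l] /= [e ->]; rewrite (inj_F i j) //; apply: val_inj.
  move=> [i k]; apply: val_inj => /=.
  rewrite -(graph_table false k (F i)) /= -hom_f ?(offs_ord k i) //.
  by rewrite (graph_table true k i).
(* The value 0 outside the range is arbitrary: [graph_iso] looks only at arguments below n. *)
pose F v := if insub v : option 'I_n is Some i then val (f i) else 0.
have FE (i : 'I_n) : F i = f i by rewrite /F valK.
exists F; split.
- by move=> v lt_v; rewrite -[v]/(val (Ordinal lt_v)) FE.
- move=> v v' lt_v lt_v'; rewrite -[v]/(val (Ordinal lt_v)) -[v']/(val (Ordinal lt_v')).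
  by rewrite !FE => /val_inj /(bij_inj bij_f) ->.
move=> _ v /offsP[q ->] lt_v; rewrite -[v]/(val (Ordinal lt_v)).
rewrite (graph_table true) !FE (graph_table false) /=.
have := ter_g (Ordinal lt_v, q); have := ini_g (Ordinal lt_v, q).
have := col_g (Ordinal lt_v, q); case: (g _) => i l /= -> ->.
by move=> <-.
Qed.

End Tables.

(** A halted configuration is a fixed point of [step] and accesses nothing, so the bound on
    addresses before halting holds at all times. *)
Lemma computes_reach w S S' P x T T' answer :
  reach w S P (start x) T (fun s => current P s = Some (Halt answer)) ->
  T <= T' -> S <= S' -> size x <= S' -> computes w P x T' S' answer.
Proof.
move=> [u [le_u halt safe]] le_T le_S le_x; split=> //.
  by exists u => //; apply: leq_trans le_T.
move=> v A; case: (ltnP v u) => [lt_v /(safe _ _ lt_v) lt_A|le_v].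
  exact: leq_trans le_S.
rewrite /run -(subnK le_v) iterD; set s := iter u _ _ in halt *.
have -> : iter (v - u) (step w P) s = s.
  elim: (v - u) => //= q ->.
  by rewrite /step halt; case: (s).
by rewrite /accessed halt.
Qed.

(** [M] words must be able to address a space that itself grows with [M], for every positive [w] at
    once. This is possible because [2 ^ (w * M)] is exponential in [M]. *)
Lemma exists_size c m : exists M, [/\ m <= M, 0 < M &
  forall w, 0 < w -> 50 * M * (c * c * 2 ^ (2 * w)) < 2 ^ (w * M)].
Proof.
(* One factor [2 ^ k] absorbs [2 * k + 2], which needs k at least 3, and another absorbs
   [50 * (c * c)]; the remaining 2 in [M] accounts for [2 ^ (2 * w)]. *)
pose k := m + 50 * (c * c) + 3; exists (2 * k + 2); split; try lia.
move=> w w_gt0.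
have le1 : 2 * k + 2 <= 2 ^ k.
  have : 3 <= k by lia.
  elim: (k) => // i IH; rewrite leq_eqVlt => /predU1P[<- //|/IH]; rewrite expnS; lia.
have lt2 : k < 2 ^ k by apply: ltn_expl.
have le3 : 2 ^ k * 2 ^ k * 2 ^ (2 * w) <= 2 ^ (w * (2 * k + 2)).
  by rewrite -!expnD leq_exp2l //; nia.
apply: leq_trans le3; rewrite mulnA ltn_pmul2r ?expn_gt0 //.
have : 50 * (c * c) <= k by lia.
nia.
Qed.

(** The specification of [main_cmd] says nothing about the final value of [x_0], so it is set again
    before being compared with the answer. *)
Definition final_cmd : cmd := block_of [:: main_cmd; Cst x_0 false].

Definition final_program (m M : nat) : program :=
  let c := compile 10 m M final_cmd 0 in
  let l := size c + 2 * M in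
  c ++ cmp_code M (x_0 + 3) (x_ans + 3) l M ++ [:: Halt false; Halt true].

Lemma final_program_reach w m M S l len T (Q : state -> Prop) :
  0 < w -> 0 < M -> m <= M -> all (gtn (2 ^ (w * m))) l ->
  M * 10 * (size l + len) <= S -> S < 2 ^ (w * M) ->
  runs (2 ^ (w * M)) (size l) (nth 0 l) (size l) len 10 main_cmd
    (State (fun=> 0) (fun _ _ => 0)) T Q ->
  exists2 s, Q s & reach w S (final_program m M)
    (start (flatten [seq words w m x | x <- l])) (slowdown 10 M * (T + 1) + 2 * M)
    (fun s' => current (final_program m M) s' = Some (Halt (0 < var s x_ans))).
Proof.
move=> w_gt0 M_gt0 le_mM lt_l le_S lt_S run_main.
have [t [s [e le_t [Qs s0]]]] : runs (2 ^ (w * M)) (size l) (nth 0 l) (size l) len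
    10 final_cmd (State (fun=> 0) (fun _ _ => 0)) (T + 1)
    (fun s => (exists2 s1, Q s1 & var s x_ans = var s1 x_ans) /\ var s x_0 = 0).
  apply: run_seq run_main _ => s Qs _; apply: run_cst; apply: run_nil.
  by split=> //; exists s.
case: Qs => s1 Qs1 eq_ans; exists s1 => //.
have [code1 code2] := code_at_cat (code_at_self (c1 := [::]) (erefl (final_program m M))).
set x := flatten _.
have sim0 : sim (size l) (nth 0 l) (size l) 10 w m M
    (State (fun=> 0) (fun _ _ => 0)) (fun=> 0) (nth 0 x).
  split=> /=.
  - by move=> r; rewrite expn_gt0.
  - move=> r; case: (ltnP r (size x)) => [lt_r|le_r]; last first.
      by rewrite nth_default ?expn_gt0.
    have : nth 0 x r \in x by apply: mem_nth.
    case/flattenP=> y /mapP[v _ ->] /mapP[i _ ->].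
    by rewrite ltn_mod expn_gt0.
  - by move=> v; rewrite /val_of digits0.
  - move=> i lt_i; rewrite -[m * i]addn0 digits_shift.
    rewrite (@eq_digits _ _ (fun j => (nth 0 l i %/ 2 ^ (w * j)) %% 2 ^ w)).
      rewrite digits_words muln0 divn1 modn_small //.
      by apply: (allP lt_l); apply: mem_nth.
    move=> j lt_j; have lt_jm : j < m by lia.
    by rewrite nth_flatten_words // nth_mkseq.
  (* The arrays lie beyond the input, where the memory is 0 at the start. *)
  move=> j i lt_j; apply: digits0 => k le_k.
  rewrite nth_default // size_flatten_words.
  apply: (@leq_trans (cell (size l) 10 M j i)); last by case/andP: le_k.
  rewrite /cell -mulnA; apply: leq_trans (leq_addr _ _).
  by apply: leq_mul => //; lia.
have le_T : slowdown 10 M * t + (2 * M + 0) <= slowdown 10 M * (T + 1) + 2 * M.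
  by rewrite addn0 leq_add2r leq_mul2l le_t orbT.
apply: (@reach_weaken _ _ _ _ _ _ (fun s' => current (final_program m M) s' =
  Some (Halt (0 < var s1 x_ans))) _ _ le_T) => //.
apply: (compile_correct w_gt0 M_gt0 _ le_mM erefl _ le_S lt_S e code1 sim0) => //.
move=> rg mm [ok _ Ev _ _]; rewrite add0n.
have [c1 c2] := code_at_cat code2.
apply: (reach_cmp w_gt0 ok _ c1); first by rewrite add0n.
rewrite !Ev s0 eq_ans; apply: reach_refl.
rewrite size_cmp_code in c2; case: c2 => h1 [h2 _].
by case: ltnP.
Qed.

Lemma size_numbers n d (a a' : d.-tuple {perm 'I_n}) :
  size (numbers a a') = 2 + d * n + d * n.
Proof. by rewrite /= size_cat !size_table. Qed.

Lemma numbers_lt n d (a a' : d.-tuple {perm 'I_n}) q :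
  n < q -> d < q -> all (gtn q) (numbers a a').
Proof.
move=> lt_n lt_d; rewrite /= lt_n lt_d all_cat.
have lt_a b : all (gtn q) (table (b : d.-tuple {perm 'I_n})).
  apply/allP => v /allpairsP[[k i] [_ _ ->]].
  exact: ltn_trans (ltn_ord _) lt_n.
by rewrite !lt_a.
Qed.

Lemma color_isomorphic1 d (a a' : d.-tuple {perm 'I_1}) :
  color_isomorphic (perm_digraph a) (perm_digraph a').
Proof.
apply/color_isomorphicP; exists id; split=> // k v ok lt_v.
have := @graph_stable 1 d a a' true k v ok lt_v.
have := @graph_stable 1 d a a' false k v ok lt_v.
by case: graph => // _; case: graph.
Qed.

Theorem theorem5 (c : nat) :
  exists (P : program) (C : nat),
    forall (w n d : nat) (a a' : d.-tuple {perm 'I_n}),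
      0 < w -> 0 < n -> 0 < d ->
      n <= c * 2 ^ w -> d <= c * 2 ^ w ->
      strongly_connected (perm_digraph a) ->
      strongly_connected (perm_digraph a') ->
      exists answer : bool,
        computes w P (input w (width c) a a')
          (C * (n ^ 2 + d * n * trunc_log 2 n)) (C * (d * n)) answer /\
        (answer <-> color_isomorphic (perm_digraph a) (perm_digraph a')).
Proof.
have [M [le_mM M_gt0 fitM]] := exists_size c (width c).
(* The first term covers the compiled command, whose 1000 is doubled to absorb the additional step;
   the second covers the last comparison, the [50 * M] of the arrays and the input itself. *)
exists (final_program (width c) M), (2000 * slowdown 10 M + 60 * M).
move=> w n d a a' w_gt0 n_gt0 d_gt0 le_n le_d con con'.
have dn_gt0 : 0 < d * n by rewrite muln_gt0 d_gt0.
have ledn : n <= d * n by rewrite leq_pmull.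
have le_dn : d * n <= c * c * 2 ^ (2 * w).
  by rewrite mul2n -addnn expnD; nia.
(* Ten arrays of M-word cells, with indices below [2 + d * n + d * n + n], which is at most
   [5 * (d * n)]. *)
pose S := 50 * M * (d * n).
have lt_S : S < 2 ^ (w * M).
  by apply: leq_ltn_trans (fitM w w_gt0); rewrite leq_mul2l le_dn orbT.
have lt_l : all (gtn (2 ^ (w * width c))) (numbers a a').
  by apply: numbers_lt; apply: width_fit.
have le_S : M * 10 * (size (numbers a a') + n) <= S.
  by rewrite size_numbers /S; nia.
have fin T answer : reach w S (final_program (width c) M)
      (start (input w (width c) a a')) (slowdown 10 M * (T + 1) + 2 * M)
      (fun s => current (final_program (width c) M) s = Some (Halt answer)) ->
    T <= 1000 * (n ^ 2 + d * n * trunc_log 2 n) ->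
    computes w (final_program (width c) M) (input w (width c) a a')
      ((2000 * slowdown 10 M + 60 * M) * (n ^ 2 + d * n * trunc_log 2 n))
      ((2000 * slowdown 10 M + 60 * M) * (d * n)) answer.
  move=> reach_halt le_T; apply: computes_reach reach_halt _ _ _.
  - have : 0 < n ^ 2 by rewrite expn_gt0 n_gt0.
    set N := n ^ 2 + _ in le_T *; move=> n2; have N_gt0 : 0 < N by rewrite /N; lia.
    move: (slowdown 10 M) => K; rewrite mulnDl -!mulnA; apply: leq_add; last by nia.
    by rewrite (mulnCA 2000) leq_mul2l; apply/orP; right; lia.
  - by rewrite /S leq_mul2r; apply/orP; right; lia.
  rewrite /input size_flatten_words size_numbers.
  apply: (@leq_trans (M * (2 + d * n + d * n))); first by rewrite leq_mul2r le_mM orbT.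
  nia.
case: (ltngtP n 1) => [|n_gt1|n1]; first by lia.
  have st b := @graph_stable n d a a' b.
  have co b : connected n (offs n d) (graph n d (nth 0 (numbers a a')) b).
    by apply: graph_connected; case: b.
  have lt_b : 4 + 4 * (d * n) < 2 ^ (w * M) by apply: leq_ltn_trans lt_S; rewrite /S; nia.
  have := run_main n_gt1 d_gt0 lt_b st co erefl erefl.
  rewrite -(size_numbers a a') => run_it.
  have [s dec /fin computes_s] :=
    final_program_reach w_gt0 M_gt0 le_mM lt_l le_S lt_S run_it.
  exists (0 < var s x_ans); split; first exact: computes_s.
  rewrite -color_isomorphicP.
  by case: dec => -[_ [-> h]]; split.
have run_it : runs (2 ^ (w * M)) (size (numbers a a')) (nth 0 (numbers a a'))
    (size (numbers a a')) n 10 main_cmd (State (fun=> 0) (fun _ _ => 0)) 10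
    (fun s => var s x_ans = 1).
  apply: run_main1; last exact: n1.
    by apply: leq_ltn_trans lt_S; rewrite /S; nia.
  by rewrite size_numbers; lia.
have [s ans /fin computes_s] :=
  final_program_reach w_gt0 M_gt0 le_mM lt_l le_S lt_S run_it.
exists true; split; last first.
  split=> // _; move: n1 a a' {con con' lt_l le_S fin run_it computes_s} => -> a a'.
  exact: color_isomorphic1.
have -> : true = (0 < var s x_ans) by rewrite ans.
by apply: computes_s; rewrite n1; lia.
Qed.
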